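(* Let $X$ be a real Banach space whose dual $X^*$ is isometrically isomorphic to $\ell_1$. Then the following are equivalent. (1) $X$ contains almost isometric copies of $c$. (2) $X^*=\ell_1$ lacks the stable $\sigma(X^*,X)$-fixed point property. (3) $r^*(X)=1$.
   Context: All spaces are real. $c$ is the space of convergent sequences with the sup norm. A Banach space $X$ contains almost isometric copies of $c$ if for every $\varepsilon>0$ there is a linear isomorphic embedding $U:c\to X$ with $(1-\varepsilon)\|x\|\le\|U(x)\|\le(1+\varepsilon)\|x\|$ for all $x\in c$. A nonempty bounded closed convex set $C$ in a Banach space has the fixed point property (FPP) if every nonexpansive map $T:C\to C$ (i.e. $\|T(x)-T(y)\|\le\|x-y\|$ for all $x,y\in C$) has a fixed point. A dual space $X^*$ has the $\sigma(X^*,X)$-FPP if every nonempty convex $\sigma(X^*,X)$-compact set $C\subset X^*$ has the FPP. $X^*$ has the stable $\sigma(X^*,X)$-FPP if there exists $\gamma>1$ such that $Y^*$ has the $\sigma(Y^*,Y)$-FPP for every Banach space $Y$ with Banach–Mazur distance $d(X,Y)<\gamma$, where $d(X,Y)=\inf\{\|T\|\|T^{-1}\|: T:X\to Y \text{ a surjective linear isomorphism}\}$. $B_Z$ is the closed unit ball of $Z$, $\operatorname{ext} K$ the set of extreme points of $K$; for $A\subseteq X^*$, $A'$ is the set of $\sigma(X^*,X)$-cluster points (weak*-accumulation points) of the set $A$. $r^*(X):=\sup\{\|g^*\| : g^*\in(\operatorname{ext} B_{X^*})'\}$. *)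

(* Defs.v *)
From HB Require Import structures.
From mathcomp Require Import all_boot all_order all_algebra.
From mathcomp Require Import all_classical all_reals all_analysis.

Set Implicit Arguments.
Unset Strict Implicit.
Unset Printing Implicit Defensive.

Import Order.TTheory GRing.Theory Num.Theory.
Import numFieldNormedType.Exports.

Local Open Scope classical_set_scope.
Local Open Scope ring_scope.

Section opnorm.
Context {R : realType} {V W : normedModType R}.

(* Only meaningful for bounded linear [f]: [sup] is a real number, with junk
   value 0 when the set is unbounded. *)
Definition opnorm (f : V -> W) : R :=
  sup [set `|f x| | x in [set x : V | `|x| <= 1]].

Lemma opnorm_has_sup (f : {linear V -> W}) : continuous f ->
  has_sup [set `|f x| | x in [set x : V | `|x| <= 1]].
Proof.
move=> cf; split; first by exists `|f 0|; exists 0; rewrite //= normr0.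
have /linear_bounded_continuous/bounded_funP/(_ 1)[M fM] := cf.
by exists M => _ [x x1 <-]; exact: fM.
Qed.

Lemma ler_opnorm (f : {linear V -> W}) (x : V) : continuous f ->
  `|f x| <= opnorm f * `|x|.
Proof.
move=> cf; have [->|x0] := eqVneq x 0.
  by rewrite linear0 !normr0 mulr0.
have nx : 0 < `|x| by rewrite normr_gt0.
rewrite -ler_pdivrMr//.
apply: (sup_upper_bound (opnorm_has_sup cf)) => /=.
exists (`|x|^-1 *: x) => /=.
  by rewrite normrZ ger0_norm ?invr_ge0// mulVf// gt_eqF.
by rewrite linearZ/= normrZ ger0_norm ?invr_ge0// mulrC.
Qed.

Lemma opnorm_le (f : V -> W) (M : R) :
  (forall x, `|x| <= 1 -> `|f x| <= M) -> opnorm f <= M.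
Proof.
move=> fM; apply: ge_sup; first by exists `|f 0|; exists 0; rewrite //= normr0.
by move=> _ [x x1 <-]; exact: fM.
Qed.

Lemma opnorm_ge (f : {linear V -> W}) (x : V) : continuous f ->
  `|x| <= 1 -> `|f x| <= opnorm f.
Proof.
move=> cf x1; apply: (sup_upper_bound (opnorm_has_sup cf)).
by exists x.
Qed.

End opnorm.

Section dual.
Context {R : realType} (X : normedModType R).

Definition dual_pred : {pred X -> R^o} :=
  mem [set f : X -> R^o | linear f /\ continuous f].

Record dual := Dual { dual_fun :> X -> R^o ; dualP : dual_fun \in dual_pred }.

HB.instance Definition _ := [isSub for dual_fun].
HB.instance Definition _ := [Choice of dual by <:].

Lemma dual_linear (f : dual) : linear f.
Proof. by have := dualP f; rewrite inE => -[]. Qed.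
Arguments dual_linear : clear implicits.

HB.instance Definition _ (f : dual) :=
  GRing.isLinear.Build R X R^o _ (dual_fun f) (dual_linear f).

Lemma dual_continuous (f : dual) : continuous f.
Proof. by have := dualP f; rewrite inE => -[]. Qed.
Arguments dual_continuous : clear implicits.

Lemma dual_submod_closed : submod_closed dual_pred.
Proof.
split=> [|a f g]; rewrite !inE/=.
  split=> [a x y|x]; first by rewrite /= scaler0 addr0.
  exact: (@cst_continuous X R^o 0).
move=> [lf cf] [lg cg]; split=> [b x y|x].
  rewrite !fctE/= lf lg !scalerDr !scalerA (mulrC b a) -!addrA; congr (_ + _).
  by rewrite addrCA.
apply: (@continuousD _ _ _ (a \*: f) g); last exact: cg.
by apply: (@continuousZl_tmp _ _ _ f a x); exact: cf.
Qed.

HB.instance Definition _ :=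
  GRing.isSubmodClosed.Build _ _ dual_pred dual_submod_closed.
HB.instance Definition _ := [SubChoice_isSubLmodule of dual by <:].

Let norm (f : dual) : R := opnorm f.

Let normD (f g : dual) : norm (f + g) <= norm f + norm g.
Proof.
apply: opnorm_le => x x1; rewrite (le_trans (ler_normD _ _))//.
by apply: lerD; apply: opnorm_ge => //; exact: (dual_continuous _).
Qed.

Let normZ_le (a : R) (f : dual) : norm (a *: f) <= `|a| * norm f.
Proof.
apply: opnorm_le => x x1; rewrite [leLHS]normrM ler_wpM2l//.
by apply: opnorm_ge => //; exact: (dual_continuous _).
Qed.

Let normZ (a : R) (f : dual) : norm (a *: f) = `|a| * norm f.
Proof.
apply/eqP; rewrite eq_le normZ_le/=.
have [->|a0] := eqVneq a 0.
  rewrite normr0 mul0r scale0r.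
  apply: le_trans (opnorm_ge (x := 0) (dual_continuous _) _) => //.
  by rewrite normr0.
have := normZ_le a^-1 (a *: f).
rewrite scalerA mulVf// scale1r normfV mulrC ler_pdivlMr ?normr_gt0//.
by rewrite mulrC.
Qed.

Let norm0_eq0 (f : dual) : norm f = 0 -> f = 0.
Proof.
move=> f0; apply/val_inj/funext => x /=; apply/eqP.
rewrite -normr_le0 -[leRHS](mul0r `|x|) -f0.
by apply: ler_opnorm; exact: (dual_continuous _).
Qed.

HB.instance Definition _ := Lmodule_isNormed.Build R dual normD normZ norm0_eq0.

Lemma dual_normE (f : dual) : `|f| = opnorm f.
Proof. by []. Qed.

(* [dual] with the topology sigma(X^*, X), that is, the topology of pointwise
   convergence on [X]; [dual] itself carries the norm topology. *)
Definition weak_star : Type :=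
  initial_topology (dual_fun : dual -> {ptws X -> R^o}).

HB.instance Definition _ := Topological.copy weak_star
  (initial_topology (dual_fun : dual -> {ptws X -> R^o})).

End dual.

Section c_space.
Context (R : realType).

Definition c_pred : {pred nat -> R^o} := mem [set u : nat -> R^o | cvgn u].

Record c_space := CSpace { c_fun :> nat -> R^o ; c_spaceP : c_fun \in c_pred }.

HB.instance Definition _ := [isSub for c_fun].
HB.instance Definition _ := [Choice of c_space by <:].

Lemma c_cvg (u : c_space) : cvgn (u : nat -> R^o).
Proof. by have := c_spaceP u; rewrite inE. Qed.
Arguments c_cvg : clear implicits.

Lemma c_submod_closed : submod_closed c_pred.
Proof.
split=> [|a u v]; rewrite !inE/=; first exact: is_cvg_cst.
move=> cu cv; apply: (@is_cvgD _ _ _ _ _ (a \*: u) v) => //.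
exact: (@is_cvgZl_tmp _ _ _ _ _ a u).
Qed.

HB.instance Definition _ :=
  GRing.isSubmodClosed.Build _ _ c_pred c_submod_closed.
HB.instance Definition _ := [SubChoice_isSubLmodule of c_space by <:].

Let norm (u : c_space) : R := sup (range (fun n => `|u n|)).

Let norm_has_sup (u : c_space) : has_sup (range (fun n => `|u n|)).
Proof.
split; first by exists `|u 0%N|; exists 0%N.
have [M [_ uM]] := cvg_seq_bounded (c_cvg u).
exists (M + 1) => _ [n _ <-]; apply: uM => //.
by rewrite ltrDl.
Qed.

Let norm_ub (u : c_space) n : `|u n| <= norm u.
Proof. by apply: (sup_upper_bound (norm_has_sup u)); exists n. Qed.

Let norm_le (u : c_space) M : (forall n, `|u n| <= M) -> norm u <= M.
Proof.
move=> uM; apply: ge_sup; first by exists `|u 0%N|; exists 0%N.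
by move=> _ [n _ <-].
Qed.

Let normD (u v : c_space) : norm (u + v) <= norm u + norm v.
Proof.
by apply: norm_le => n; rewrite (le_trans (ler_normD _ _))// lerD.
Qed.

Let normZ_le (a : R) (u : c_space) : norm (a *: u) <= `|a| * norm u.
Proof. by apply: norm_le => n; rewrite [leLHS]normrM ler_wpM2l. Qed.

Let normZ (a : R) (u : c_space) : norm (a *: u) = `|a| * norm u.
Proof.
apply/eqP; rewrite eq_le normZ_le/=.
have [->|a0] := eqVneq a 0.
  by rewrite normr0 mul0r scale0r (le_trans _ (norm_ub _ 0%N)).
have := normZ_le a^-1 (a *: u).
rewrite scalerA mulVf// scale1r normfV mulrC ler_pdivlMr ?normr_gt0//.
by rewrite mulrC.
Qed.

Let norm0_eq0 (u : c_space) : norm u = 0 -> u = 0.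
Proof.
move=> u0; apply/val_inj/funext => n /=; apply/eqP.
by rewrite -normr_le0 -u0.
Qed.

HB.instance Definition _ :=
  Lmodule_isNormed.Build R c_space normD normZ norm0_eq0.

Lemma c_normE (u : c_space) : `|u| = sup (range (fun n => `|u n|)).
Proof. by []. Qed.

End c_space.

Section ell1.
Context (R : realType).

Definition ell1_pred : {pred nat -> R^o} :=
  mem [set u : nat -> R^o | cvgn [normed series u]].

Record ell1 := Ell1 { ell1_fun :> nat -> R^o ; ell1P : ell1_fun \in ell1_pred }.

HB.instance Definition _ := [isSub for ell1_fun].
HB.instance Definition _ := [Choice of ell1 by <:].

Lemma ell1_cvg (u : ell1) : cvgn [normed series (u : nat -> R^o)].
Proof. by have := ell1P u; rewrite inE. Qed.
Arguments ell1_cvg : clear implicits.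

Lemma ell1_submod_closed : submod_closed ell1_pred.
Proof.
split=> [|a u v]; rewrite !inE/=.
  rewrite (_ : [normed series _] = cst 0); first exact: is_cvg_cst.
  by apply/funext => n; apply: big1 => i _; exact: normr0.
move=> cu cv.
apply: (@series_le_cvg _ _ (fun n => `|a| * `|u n| + `|v n|)).
- by move=> n; exact: normr_ge0.
- by move=> n; apply: addr_ge0 => //; exact: mulr_ge0.
- move=> n; apply: le_trans (ler_normD _ _) _.
  by rewrite lerD2r [leLHS]normrM.
- have cau : cvgn (series (`|a| *: (fun n => `|u n| : R^o))).
    exact: is_cvg_seriesZ.
  exact: (is_cvg_seriesD cau cv).
Qed.

HB.instance Definition _ :=
  GRing.isSubmodClosed.Build _ _ ell1_pred ell1_submod_closed.
HB.instance Definition _ := [SubChoice_isSubLmodule of ell1 by <:].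

Let norm (u : ell1) : R := limn [normed series (u : nat -> R^o)].

Let normD (u v : ell1) : norm (u + v) <= norm u + norm v.
Proof.
rewrite /norm -lim_seriesD; [|exact: (ell1_cvg _)|exact: (ell1_cvg _)].
apply: lim_series_le; [exact: (ell1_cvg _)| |].
  by apply: is_cvg_seriesD; exact: (ell1_cvg _).
by move=> n; exact: ler_normD.
Qed.

Let normZ (a : R) (u : ell1) : norm (a *: u) = `|a| * norm u.
Proof.
rewrite /norm -[RHS]/(`|a| *: _) -lim_seriesZ; last exact: (ell1_cvg _).
by congr (limn (series _)); apply/funext => n; exact: normrM.
Qed.

Let norm0_eq0 (u : ell1) : norm u = 0 -> u = 0.
Proof.
move=> u0; apply/val_inj/funext => n /=; apply/eqP.
rewrite -normr_le0 -u0.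
pose s := series (fun k => `|u k|).
have nd : nondecreasing_seq s.
  by apply/nondecreasing_seqP => k; rewrite /s seriesSr lerDl.
apply: le_trans (nondecreasing_cvgn_le nd (ell1_cvg u) n.+1).
by rewrite /s seriesS lerDl; exact: sumr_ge0.
Qed.

HB.instance Definition _ := Lmodule_isNormed.Build R ell1 normD normZ norm0_eq0.

Lemma ell1_normE (u : ell1) : `|u| = limn [normed series (u : nat -> R^o)].
Proof. by []. Qed.

End ell1.

Section isomorphisms.
Context {R : realType}.
Implicit Types V W X Y : normedModType R.

Definition isometrically_isomorphic V W : Prop :=
  exists T : {linear V -> W}, bijective T /\ forall x, `|T x| = `|x|.

Definition isomorphic_embedding V W (U : V -> W) : Prop :=
  continuous U /\
  exists2 S : W -> V, cancel U S & {within range U, continuous S}.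

Definition almost_isometric_copies_c X : Prop :=
  forall e : R, 0 < e -> exists U : {linear c_space R -> X},
    isomorphic_embedding U /\
    forall x, (1 - e) * `|x| <= `|U x| <= (1 + e) * `|x|.

(* [+oo] when [X] and [Y] are not isomorphic *)
Definition bm_distance X Y : \bar R :=
  ereal_inf [set d | exists (T : {linear X -> Y}) (S : {linear Y -> X}),
    [/\ continuous T, continuous S, cancel T S, cancel S T &
        d = (opnorm T * opnorm S)%:E]].

End isomorphisms.

Section fixed_points.
Context {R : realType}.

Definition nonexpansive (E : normedModType R) (C : set E) (T : E -> E) : Prop :=
  {in C &, forall x y, `|T x - T y| <= `|x - y|}.

Definition fixed_point_property (E : normedModType R) (C : set E) : Prop :=
  forall T : {fun C >-> C}, nonexpansive C T -> exists2 x, C x & T x = x.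

(* Weak-star compact sets are bounded and norm closed, so every such [C] is in
   the class of sets for which the fixed point property is considered. *)
Definition weak_star_fpp (X : completeNormedModType R) : Prop :=
  forall C : set (dual X), C !=set0 -> convex_set C ->
    compact (C : set (weak_star X)) -> fixed_point_property C.

Definition stable_weak_star_fpp (X : completeNormedModType R) : Prop :=
  exists2 gamma : R, 1 < gamma &
    forall Y : completeNormedModType R,
      (bm_distance X Y < gamma%:E)%E -> weak_star_fpp Y.

End fixed_points.

Section rstar.
Context {R : realType}.

Definition unit_ball (E : normedModType R) : set E := [set x | `|x| <= 1].
Arguments unit_ball : clear implicits.

Definition extreme_points (E : lmodType R) (K : set E) : set E :=
  [set x | K x /\ forall y z (t : R), K y -> K z -> 0 < t < 1 ->
    x = t *: y + (1 - t) *: z -> y = x /\ z = x].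

(* [limit_point]: every weak-star neighbourhood of [g] contains a point of [A]
   other than [g]; a point of [A] itself need not qualify. *)
Definition weak_star_cluster (X : normedModType R) (A : set (dual X)) :
    set (dual X) :=
  limit_point (A : set (weak_star X)).

Definition rstar (X : normedModType R) : R :=
  sup [set `|g| |
    g in weak_star_cluster (extreme_points (unit_ball (dual X)))].

End rstar.

(* Main.v *)
Require Import Defs.
From HB Require Import structures.
From mathcomp Require Import all_boot all_order all_algebra.
From mathcomp Require Import all_classical all_reals all_analysis.
From mathcomp Require Import ring lra.

(** (1) => (2): the coordinate functionals of a (1 + e)-copy of c extend to X;
    after renorming X by their supremum they have norm at most 1, and a weak-star
    convergent subsequence together with its limit spans isometrically an l1.
    The right shift of the corresponding simplex is isometric without fixed point.

    (2) => (3): let r = rstar X < 1 and d (1 + r) < 2, where d bounds the distance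
    from X to Y. Along an ultrafilter, an approximate fixed point sequence (x_n)
    has a coordinatewise limit z in l1 and a weak-star limit x, and
    lim |x_n - y| = L + |z - y| with L = lim |x_n - z|, whereas |x - z| <= r L.
    Hence { y | lim |x_n - y| <= d (1 + r) L } is nonempty, convex and invariant,
    and a new approximate fixed point sequence inside it has
    L' + |z' - z| <= (d (1 + r) - 1) L. Iterating, L tends to 0 and the z's
    converge to a fixed point.

    (3) => (1): let g be a cluster point of norm close to 1 and g(x0) close to 1.
    The extreme points are the signed basis functionals of l1, so one can
    recursively find x_k in X and functionals f_k close to g such that f_k(x_k) is
    close to 1 and all the x0 - 2 (x_j1 + ... + x_jm) have norm at most 1 + e.
    Then u |-> lim u x0 + sum_k (u_k - lim u) x_k almost preserves the norm of c. *)

Set Implicit Arguments.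
Unset Strict Implicit.
Unset Printing Implicit Defensive.

Import Order.TTheory GRing.Theory Num.Theory.
Import numFieldNormedType.Exports.

Local Open Scope classical_set_scope.
Local Open Scope ring_scope.

(** * Hahn-Banach theorem and ultrafilters *)

(** Coordinatewise limits make the l1 norm asymptotically additive but may leave [C]; weak-star
    limits stay in [C] but need not respect the coordinates of l1. In (2) => (3) both limits of one
    sequence are therefore kept, and [rstar] enters only as a bound on their distance. The condition
    d (1 + r) < 2 says exactly that the factor d (1 + r) - 1 is below 1. Limits along an ultrafilter
    make every bounded scalar net converge, including those that involve points chosen later. In (3)
    => (1) the natural candidate for x_k is a signed unit vector of the bidual l-infinity: it has
    the right value at f_k and almost vanishes at g, but it lies outside X. A Helly type argument
    replaces it by a vector of X at an arbitrarily small cost, so the recursion runs on strict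
    inequalities. The vector x0 - 2 (x_j1 + ... + x_jm) is the image of the sequence equal to -1 at
    the j's and to 1 elsewhere: the bound is a test on signs. In (1) => (2) an almost isometric l1
    would not do, because nonexpansiveness admits no loss; the renorming makes it isometric. *)

Section hahn_banach.
Context {R : realType} {V : lmodType R}.
Implicit Types (p q : V -> R) (S : set (V * R)).

Definition sublinear p :=
  (forall x y, p (x + y) <= p x + p y) /\
  (forall t x, 0 < t -> p (t *: x) <= t * p x).

Lemma sublinearZ p t x : sublinear p -> 0 < t -> p (t *: x) = t * p x.
Proof.
move=> [_ pZ] t0; apply/eqP; rewrite eq_le pZ//= -ler_pdivlMl//.
by rewrite -[in leLHS](scalerK (lt0r_neq0 t0) x) pZ// invr_gt0.
Qed.

Lemma sublinear0 p : sublinear p -> p 0 = 0.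
Proof.
move=> sp; have := sublinearZ 0 sp (ltr0n R 2); rewrite scaler0.
by move=> ?; lra.
Qed.

Lemma sublinear_ge p x : sublinear p -> - p (- x) <= p x.
Proof.
move=> sp; rewrite lerNl -subr_ge0 opprK -(sublinear0 sp) -[X in p X](addNr x).
exact: sp.1.
Qed.

Definition convex_cone S :=
  [/\ S (0, 0), (forall a b, S a -> S b -> S (a + b)) &
      forall t a, 0 < t -> S a -> S (t *: a.1, t * a.2)].

(** For a convex cone [S], a linear functional lies below [lowered p S] exactly when it lies below
    [p] and is at least [a.2] at [a.1] for every [a] in [S]: two constraints become one
    domination. *)
Definition lowered p S x : R := inf [set p (x + a.1) - a.2 | a in S].

Section lowered.
Variables (p : V -> R) (S : set (V * R)).
Hypotheses (sp : sublinear p) (cS : convex_cone S)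
  (Sp : forall a, S a -> a.2 <= p a.1).

Let lb x : lbound [set p (x + a.1) - a.2 | a in S] (- p (- x)).
Proof.
move=> _ [a Sa <-]; have := sp.1 (x + a.1) (- x); rewrite addrAC subrr add0r.
by have := Sp Sa; lra.
Qed.

Lemma lowered_le a x : S a -> lowered p S x <= p (x + a.1) - a.2.
Proof. by move=> Sa; apply: ge_inf; [exists (- p (- x)); exact: lb|exists a]. Qed.

Lemma le_lowered c x : (forall a, S a -> c <= p (x + a.1) - a.2) ->
  c <= lowered p S x.
Proof.
move=> ch; apply: lb_le_inf; last by move=> _ [a Sa <-]; exact: ch.
by exists (p (x + 0) - 0); exists (0, 0) => //; case: cS.
Qed.

Lemma sublinear_lowered : sublinear (lowered p S).
Proof.
case: (cS) => S0 SD SZ; split=> [x y|t x t0].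
  rewrite -lerBlDr; apply: le_lowered => a Sa.
  rewrite lerBlDr -lerBlDl; apply: le_lowered => b Sb.
  apply: le_trans (lerB (lowered_le _ (SD _ _ Sa Sb)) (lexx _)) _ => /=.
  by rewrite addrACA; have := sp.1 (x + a.1) (y + b.1); lra.
rewrite -ler_pdivrMl//; apply: le_lowered => a Sa.
rewrite ler_pdivrMl//; apply: le_trans (lowered_le _ (SZ _ _ t0 Sa)) _ => /=.
by rewrite -scalerDr (sublinearZ _ sp t0) mulrBr.
Qed.

Lemma lowered_id x : lowered p S x <= p x.
Proof.
case: cS => S0 _ _; apply: le_trans (lowered_le x S0) _.
by rewrite addr0 subr0.
Qed.

Lemma lowered_opp a : S a -> lowered p S (- a.1) <= - a.2.
Proof.
move=> Sa; apply: le_trans (lowered_le _ Sa) _.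
by rewrite addNr (sublinear0 sp) sub0r.
Qed.

End lowered.

(** Zorn's lemma: a chain is bounded by its pointwise infimum, which is finite because every
    sublinear [q] below [p] satisfies [- p (- x) <= q x]. *)
Lemma minimal_sublinear p : sublinear p -> exists q, [/\ sublinear q,
  forall x, q x <= p x & forall r, sublinear r -> (forall x, r x <= q x) ->
  forall x, q x <= r x].
Proof.
move=> sp; pose T := {q | sublinear q /\ forall x, q x <= p x}.
pose le (a b : T) := `[< forall x, sval b x <= sval a x >].
have pT : sublinear p /\ forall x, p x <= p x by [].
have [||A tA|[q [sq qp]] qmin] := @ZL_preorder T (exist _ p pT) le.
- by move=> a; exact/asboolP.
- move=> a b c /asboolP ba /asboolP ac; apply/asboolP => x.
  exact: le_trans (ac x) (ba x).
- have [[a0 Aa0]|A0] := pselect (A !=set0); last first.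
    by exists (exist _ p pT) => a Aa; exfalso; apply: A0; exists a.
  pose q x := inf [set sval a x | a in A].
  have qlb x : has_lbound [set sval a x | a in A].
    exists (- p (- x)) => _ [a Aa <-]; case: a Aa => a [sa ap] _ /=.
    by apply: le_trans (sublinear_ge x sa); rewrite lerN2.
  have qle a x : A a -> q x <= sval a x by move=> Aa; apply: ge_inf => //; exists a.
  have le_q c x : (forall a, A a -> c <= sval a x) -> c <= q x.
    move=> ch; apply: lb_le_inf; first by exists (sval a0 x); exists a0.
    by move=> _ [a Aa <-]; exact: ch.
  have sq : sublinear q.
    split=> [x y|t x t0].
      rewrite -lerBlDr; apply: (le_q) => a Aa.
      rewrite lerBlDr -lerBlDl; apply: (le_q) => b Ab; rewrite lerBlDl.
      (* Of two members of the chain the smaller one serves for both terms, so the infimum is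
         subadditive. *)
      have [/asboolP ab|/asboolP ba] := tA _ _ Aa Ab.
        apply: le_trans (qle _ _ Ab) _; case: (svalP b) => sb _.
        by apply: le_trans (sb.1 x y) _; rewrite lerD2r; exact: ab.
      apply: le_trans (qle _ _ Aa) _; case: (svalP a) => sa _.
      by apply: le_trans (sa.1 x y) _; rewrite lerD2l; exact: ba.
    rewrite -ler_pdivrMl//; apply: (le_q) => a Aa; rewrite ler_pdivrMl//.
    by case: (svalP a) => sa _; rewrite -sublinearZ//; exact: qle.
  have qp x : q x <= p x by apply: le_trans (qle _ x Aa0) _; case: (svalP a0).
  by exists (exist _ q (conj sq qp)) => a Aa; apply/asboolP => x; exact: qle.
exists q; split => // r sr rq x.
have rp y : r y <= p y by exact: le_trans (rq y) (qp y).
have := qmin (exist _ r (conj sr rp)); rewrite /le /= => h.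
by move/asboolP : (h (asboolT rq)).
Qed.

(* Hahn-Banach in the form of Mazur and Orlicz; a minimal sublinear functional
   is odd, hence linear. *)
Lemma mazur_orlicz p S : sublinear p -> convex_cone S ->
  (forall a, S a -> a.2 <= p a.1) ->
  exists f : {linear V -> R^o}, (forall x, f x <= p x) /\
    forall a, S a -> a.2 <= f a.1.
Proof.
move=> sp cS Sp.
have [q [sq qp qmin]] := minimal_sublinear (sublinear_lowered sp cS Sp).
have qN x : q (- x) = - q x.
  apply/eqP; rewrite eq_le; apply/andP; split; last first.
    by rewrite lerNl -{2}[x]opprK; have := sublinear_ge (- x) sq; rewrite !opprK lerNl.
  (* Lowering [q] along the ray through [(x, q x)] gives a value at most [- q x] at [- x]; by
     minimality [q] lies below the lowered functional. *)
  pose D := [set (t *: x, t * q x) | t in [set t : R | 0 <= t]].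
  have cD : convex_cone D.
    split; first by exists 0; rewrite /= ?scale0r ?mul0r.
      move=> _ _ [t t0 <-] [s s0 <-]; exists (t + s); first exact: addr_ge0.
      by rewrite scalerDl mulrDl.
    move=> t _ t0 [s s0 <-] /=; exists (t * s); first by rewrite /= mulr_ge0// ltW.
    by rewrite scalerA mulrA.
  have Dq a : D a -> a.2 <= q a.1.
    move=> [t]; rewrite /= le_eqVlt => /predU1P[<- <-|t0 <-] /=.
      by rewrite scale0r mul0r sublinear0.
    by rewrite sublinearZ.
  apply: le_trans (qmin _ (sublinear_lowered sq cD Dq) (lowered_id sq cD Dq) _) _.
  have := @lowered_opp q D sq Dq (1 *: x, 1 * q x); rewrite /= scale1r mul1r; apply.
  by exists 1; rewrite /= ?ler01// scale1r mul1r.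
have qD x y : q (x + y) = q x + q y.
  apply/eqP; rewrite eq_le sq.1/= -[x + y]opprK qN lerNr !opprD -!qN.
  exact: sq.1.
have qZ t x : q (t *: x) = t * q x.
  have [t0|t0|->] := ltrgt0P t.
  - exact: sublinearZ.
  - by rewrite -[t]opprK scaleNr qN sublinearZ ?oppr_gt0// !mulNr.
  - by rewrite scale0r mul0r sublinear0.
have lq : linear (q : V -> R^o) by move=> t x y; rewrite qD qZ.
pose f : {linear V -> R^o} := HB.pack (q : V -> R^o) (GRing.isLinear.Build _ _ _ _ _ lq).
exists f; split=> [x|a Sa]; first exact: le_trans (qp x) (lowered_id sp cS Sp x).
by rewrite -lerN2 -qN; exact: le_trans (qp _) (lowered_opp sp Sp Sa).
Qed.

End hahn_banach.

Section ultrafilters.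

Lemma ultra_fmap T U (f : T -> U) (F : set_system T) :
  UltraFilter F -> UltraFilter (f @ F).
Proof.
move=> FU; split=> [|G GF sFG]; first exact: fmap_proper_filter.
rewrite eqEsubset; split => // A GA.
have [//|FnA] := in_ultra_setVsetC (f @^-1` A) FU.
have /(filterI GA) : G (~` A) by exact: sFG.
by rewrite setICr => /filter_not_empty.
Qed.

(** When [A] is an infinite set of bad indices, a limit along [F] retains the bad behaviour; this is
    how eventual bounds are proved by contradiction below. *)
Lemma free_ultrafilter (A : set nat) :
  (forall N, exists2 n, (N <= n)%N & A n) ->
  exists F : set_system nat, [/\ UltraFilter F, F A & \oo `<=` F].
Proof.
move=> iA.
have FF : ProperFilter (within A \oo).
  apply: Build_ProperFilter_ex => B [N _ NB].
  by have [n nN An] := iA N; exists n; exact: NB.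
have [F [FU sF]] := ultraFilterLemma FF; exists F; split => //.
  by apply: sF; exists 0%N.
by move=> B [N _ NB]; apply: sF; exists N => // n nN _; exact: NB.
Qed.

Context {R : realType} {T : Type} (F : set_system T) {FU : UltraFilter F}.

Lemma ultra_bounded_cvg (f : T -> R^o) (M : R) : (\forall t \near F, `|f t| <= M) ->
  exists l : R^o, f @ F --> l.
Proof.
move=> fM; have := @segment_compact R (- M) M; rewrite compact_ultra.
move=> /(_ (f @ F) (ultra_fmap f FU))[].
  by apply: filterS fM => t; rewrite ler_norml => h /=; rewrite in_itv.
by move=> l [_ fl]; exists l.
Qed.

End ultrafilters.

(** * Dual spaces and the weak-star topology *)

Lemma bounded_linear_continuous {R : realType} (V W : normedModType R)
    (f : {linear V -> W}) (M : R) :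
  (forall x, `|f x| <= M * `|x|) -> continuous f.
Proof.
move=> fM; apply/linear_bounded_continuous/bounded_funP => r.
exists (`|M| * r) => x xr; apply: le_trans (fM x) _.
by apply: le_trans (ler_wpM2l (normr_ge0 _) xr); rewrite ler_wpM2r// ler_norm.
Qed.

Section dual_theory.
Context {R : realType}.
Implicit Types X Y : normedModType R.

Lemma dual_le_norm X (f : dual X) (x : X) : `|f x| <= `|f| * `|x|.
Proof. exact: (ler_opnorm _ (dual_continuous (f := f))). Qed.

Lemma dual_norm_le X (f : dual X) (M : R) : 0 <= M ->
  (forall x, `|f x| <= M * `|x|) -> `|f| <= M.
Proof.
move=> M0 fM; apply: opnorm_le => x x1; apply: le_trans (fM x) _.
by rewrite ler_piMr.
Qed.

Lemma dual_norm_gt X (f : dual X) (c : R) : c < `|f| ->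
  exists2 x, `|x| <= 1 & c < f x.
Proof.
move=> cf; have [|_ [x x1 <-]] := @sup_adherent _ _ (`|f| - c) _ (opnorm_has_sup
  (@dual_continuous _ _ f)).
  by rewrite subr_gt0.
rewrite -[sup _]/(`|f|) opprB addrCA subrr addr0 => cfx.
have [fx0|fx0] := leP 0 (f x); first by exists x => //; rewrite -(ger0_norm fx0).
by exists (- x); rewrite ?normrN// linearN/= -(ltr0_norm fx0).
Qed.

Lemma dual_of X (f : X -> R^o) (M : R) : linear f ->
  (forall x, `|f x| <= M * `|x|) -> exists g : dual X, forall x, g x = f x.
Proof.
move=> lf fM.
pose f' : {linear X -> R^o} := HB.pack f (GRing.isLinear.Build _ _ _ _ _ lf).
have cf : continuous f' by exact: (@bounded_linear_continuous R X R^o f' M fM).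
have df : f \in @dual_pred _ X by rewrite inE.
by exists (Dual df).
Qed.

(** The Banach-Alaoglu theorem in ultrafilter form: the scalar limits are linear in [x] and keep the
    bound. *)
Lemma dual_ultra_limit X T (F : set_system T) (h : T -> dual X) (M : R) :
  UltraFilter F -> (forall t, `|h t| <= M) ->
  exists2 g : dual X, `|g| <= M & forall x, (h t x : R^o) @[t --> F] --> (g x : R^o).
Proof.
move=> FU hM.
have [t0 _] := filter_ex (filterT : F setT).
have M0 : 0 <= M by apply: le_trans (hM t0).
have hx x t : `|h t x| <= M * `|x|.
  by apply: le_trans (dual_le_norm _ _) _; rewrite ler_wpM2r.
have /choice[g hg] x : exists l : R^o, (h t x : R^o) @[t --> F] --> l.
  apply: (@ultra_bounded_cvg R T F FU (fun t => h t x) (M * `|x|)).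
  by near=> t; exact: hx.
have gM x : `|g x| <= M * `|x|.
  by apply: (cvgr_to_le (cvg_norm (hg x))); near=> t; exact: hx.
have lg : linear (g : X -> R^o).
  move=> a x y; apply: (cvg_unique _ (hg (a *: x + y))) => //.
  rewrite (_ : (fun t => _) = (fun t => a *: h t x + h t y)); last first.
    by apply/funext => t; rewrite linearP.
  exact: (cvgD (cvgZr (hg x)) (hg y)).
have [f fE] := dual_of lg gM; exists f; last by move=> x; rewrite fE.
by apply: dual_norm_le => // x; rewrite fE.
Unshelve. all: by end_near. Qed.

Lemma weak_star_cvgP X (F : set_system (dual X)) (g : dual X) : Filter F ->
  (F --> (g : weak_star X)) <-> forall x, (h x : R^o) @[h --> F] --> (g x : R^o).
Proof.
move=> FF; split=> [Fg x|Fg].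
  have : (@dual_fun R X) @ F --> (g : {ptws X -> R^o}).
    move=> A /= nA; apply: Fg.
    exact: (@initial_continuous _ _ (@dual_fun R X : dual X -> {ptws X -> R^o}) g A).
  by move/pointwise_cvgP => /(_ x).
have : (@dual_fun R X) @ F --> (g : {ptws X -> R^o}) by exact/pointwise_cvgP.
move=> dF A [_ /= [[B oB <-]]] /= gB /filterS; apply.
by apply: dF; exact: open_nbhs_nbhs.
Qed.

Lemma weak_star_compact_limit X (C : set (dual X)) T (F : set_system T)
    (h : T -> dual X) : UltraFilter F -> compact (C : set (weak_star X)) ->
    (forall t, C (h t)) ->
  exists2 g, C g & forall x, (h t x : R^o) @[t --> F] --> (g x : R^o).
Proof.
move=> FU; rewrite compact_ultra => cC Ch.
have [|g [Cg /weak_star_cvgP Fg]] := cC (h @ F) (ultra_fmap h FU).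
  exact: (filterS (fun t _ => Ch t) filterT).
by exists g => // x; exact: Fg.
Qed.

Lemma weak_star_compactI X (C : set (dual X)) :
  (forall F : set_system (dual X), UltraFilter F -> F C ->
    exists2 g, C g & forall x, (h x : R^o) @[h --> F] --> (g x : R^o)) ->
  compact (C : set (weak_star X)).
Proof.
move=> CF; rewrite compact_ultra => F FU FC.
have [g Cg Fg] := CF F FU FC; exists g; split => //.
exact/weak_star_cvgP.
Qed.

(** Evaluation at [x] is weak-star continuous, so [C] is pointwise bounded, and the uniform
    boundedness principle applies on the complete space [X]. *)
Lemma weak_star_compact_bounded (X : completeNormedModType R) (C : set (dual X)) :
  compact (C : set (weak_star X)) -> exists M, forall f, C f -> `|f| <= M.
Proof.
move=> cC.
have [||M hM] := @Banach_Steinhauss R X R^o [set (f : X -> R^o) | f in C] _ _ 1.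
- move=> _ [f Cf <-]; split; last exact: dual_linear.
  move=> r; exists (`|f| * r) => x xr; apply: le_trans (dual_le_norm _ _) _.
  by rewrite ler_wpM2l.
- move=> x.
  have cx : compact [set (f x : R^o) | f in C].
    apply: (@continuous_compact (weak_star X) R^o (fun f : dual X => f x)) => //.
    apply: continuous_subspaceT => f.
    have /weak_star_cvgP := @cvg_id (weak_star X) (nbhs (f : weak_star X)).
    exact.
  have [M [_ hM]] := compact_bounded cx.
  exists (M + 1) => _ [f Cf <-]; apply: (hM (M + 1)); first by rewrite ltrDl.
  by exists f.
exists (Num.max M 0) => f Cf; apply: opnorm_le => x x1.
by rewrite le_max hM//; exists f.
Qed.

End dual_theory.

(** * The space l1 *)

Definition psum {R : realType} (u : ell1 R) n : R := \sum_(0 <= k < n) `|u k|.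

Section ell1_theory.
Context {R : realType}.
Implicit Types u v : ell1 R.

Lemma psum_cat u N M : (N <= M)%N ->
  psum u M = psum u N + \sum_(N <= k < M) `|u k|.
Proof. by move=> NM; rewrite /psum (big_cat_nat (leq0n N) NM). Qed.

Lemma psum_mono u N M : (N <= M)%N -> psum u N <= psum u M.
Proof. by move=> NM; rewrite (psum_cat _ NM) lerDl sumr_ge0. Qed.

Lemma ell1_psum_cvg u : (psum u n : R) @[n --> \oo] --> (`|u| : R).
Proof. exact: (ell1_cvg (u := u)). Qed.

Arguments ell1_psum_cvg : clear implicits.

Lemma ell1_psum_le u n : psum u n <= `|u|.
Proof.
apply: (@nondecreasing_cvgn_le _ [normed series (u : nat -> R^o)]).
  by apply: nondecreasing_series => k _ _; exact: normr_ge0.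
exact: (ell1_cvg (u := u)).
Qed.

Lemma ell1_norm_le u (M : R) : (forall n, psum u n <= M) -> `|u| <= M.
Proof. by move=> uM; apply: (cvgr_to_le (ell1_psum_cvg u)); near=> n; exact: uM.
Unshelve. all: by end_near. Qed.

Lemma ell1_coord_le u k : `|u k| <= `|u|.
Proof.
apply: le_trans (ell1_psum_le u k.+1).
by rewrite /psum big_nat_recr//= lerDr; exact: sumr_ge0.
Qed.

Lemma ell1_of (f : nat -> R) (M : R) : (forall n, \sum_(0 <= k < n) `|f k| <= M) ->
  exists u, forall k, u k = f k.
Proof.
move=> fM.
have cf : (f : nat -> R^o) \in @ell1_pred R.
  rewrite inE; apply: nondecreasing_is_cvgn.
    by apply: nondecreasing_series => k _ _; exact: normr_ge0.
  by exists M => _ [n _ <-]; exact: fM.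
by exists (Ell1 cf).
Qed.

Lemma ell1_ext u v : (forall k, u k = v k) -> u = v.
Proof. by move=> uv; apply/val_inj/funext => k; exact: uv. Qed.

Let psum_delta n m : \sum_(0 <= k < m) `|(k == n)%:R : R| <= 1.
Proof.
rewrite (eq_bigr (fun k => (k == n)%:R)); last by move=> k _; rewrite normr_nat.
have [nm|mn] := ltnP n m.
  rewrite big_mkord (bigD1 (Ordinal nm))//= eqxx big1 ?addr0// => i.
  by rewrite -val_eqE /= => /negPf ->.
by rewrite big_nat_cond big1// => i /andP[/andP[_ im] _];
  rewrite ltn_eqF// (leq_trans im).
Qed.

Definition ell1_basis n : ell1 R := sval (cid (ell1_of (psum_delta n))).
Arguments ell1_basis : simpl never.

Lemma ell1_basisE n k : ell1_basis n k = (k == n)%:R.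
Proof. by rewrite /ell1_basis; case: cid. Qed.

Lemma ell1_basis_norm n : `|ell1_basis n| = 1.
Proof.
apply/eqP; rewrite eq_le; apply/andP; split.
  by apply: ell1_norm_le => m; rewrite /psum; under eq_bigr do rewrite ell1_basisE;
    exact: psum_delta.
by apply: le_trans (ell1_coord_le _ n); rewrite ell1_basisE eqxx normr1.
Qed.

Lemma ell1_sumE I (r : seq I) (P : pred I) (F : I -> ell1 R) k :
  (\sum_(i <- r | P i) F i) k = \sum_(i <- r | P i) F i k.
Proof. by elim/big_rec2 : _ => // i x y _ <-. Qed.

Definition ell1_tail N u : ell1 R := u - \sum_(0 <= k < N) u k *: ell1_basis k.
Arguments ell1_tail : simpl never.

Lemma ell1_tailE N u k : ell1_tail N u k = if (k < N)%N then 0 else u k.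
Proof.
rewrite /ell1_tail -[LHS]/(u k - (\sum_(0 <= i < N) u i *: ell1_basis i) k) ell1_sumE.
rewrite (eq_bigr (fun i => u i * (k == i)%:R)); last first.
  by move=> i _; rewrite -(ell1_basisE i k).
rewrite big_mkord; have [kN|Nk] := ltnP k N.
  rewrite (bigD1 (Ordinal kN))//= eqxx mulr1 big1 ?addr0 ?subrr// => i.
  by rewrite -val_eqE eq_sym /= => /negPf ->; rewrite mulr0.
rewrite big1 ?subr0// => i _.
by rewrite gtn_eqF ?mulr0// (leq_trans (ltn_ord i)).
Qed.

Lemma ell1_tail_norm N u : `|ell1_tail N u| = `|u| - psum u N.
Proof.
have tail M : (N <= M)%N -> psum (ell1_tail N u) M = psum u M - psum u N.
  move=> NM; rewrite !(psum_cat _ NM) [psum (ell1_tail N u) N]big_nat_cond.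
  rewrite big1 ?add0r => [|i /andP[/andP[_ iN] _]]; last first.
    by rewrite ell1_tailE iN normr0.
  rewrite addrAC subrr add0r; apply: eq_big_nat => k /andP[Nk _].
  by rewrite ell1_tailE ltnNge Nk.
apply: (cvg_unique _ (ell1_psum_cvg _)) => //.
apply: cvg_trans (cvgB (ell1_psum_cvg u) (cvg_cst (psum u N))).
by apply: near_eq_cvg; near=> M; rewrite tail//; near: M; exact: nbhs_infty_ge.
Unshelve. all: by end_near. Qed.

Lemma ell1_tail_cvg u : (`|ell1_tail N u| : R) @[N --> \oo] --> (0 : R).
Proof.
rewrite (_ : (fun N => _) = (fun N => `|u| - psum u N)); last first.
  by apply/funext => N; exact: ell1_tail_norm.
by rewrite -[X in _ --> X](subrr `|u|); exact: cvgB (cvg_cst _) (ell1_psum_cvg u).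
Qed.

Arguments ell1_tail_cvg : clear implicits.

(** The first [N] coordinates are estimated by the global bound, the others by the values at basis
    vectors; when [u] has little mass before [N], only [b] counts. *)
Lemma ell1_functional_le (phi : {linear ell1 R -> R^o}) (B b : R) N u :
  (forall v, `|phi v| <= B * `|v|) -> 0 <= b ->
  (forall k, (N <= k)%N -> `|phi (ell1_basis k)| <= b) ->
  `|phi u| <= B * psum u N + b * `|u|.
Proof.
move=> phiB b0 phib.
have cB : (B * psum u N + b * `|u| + B * `|ell1_tail M u|) @[M --> \oo] -->
    (B * psum u N + b * `|u|).
  rewrite -[X in _ --> X]addr0 -[X in _ --> _ + X](mulr0 B).
  exact: cvgD (cvg_cst _) (cvgMl_tmp (ell1_tail_cvg u)).
apply: (cvgr_to_ge cB); near=> M.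
have NM : (N <= M)%N by near: M; exact: nbhs_infty_ge.
have {1}-> : u = \sum_(0 <= k < M) u k *: ell1_basis k + ell1_tail M u.
  by rewrite /ell1_tail addrC subrK.
rewrite linearD linear_sum/=; apply: le_trans (ler_normD _ _) _.
apply: lerD (phiB _); apply: le_trans (ler_norm_sum _ _ _) _.
rewrite (big_cat_nat (leq0n N) NM)//=; apply: lerD.
  rewrite /psum mulr_sumr; apply: ler_sum => k _.
  rewrite linearZ/= [leLHS]normrM mulrC ler_wpM2r//.
  by apply: le_trans (phiB _) _; rewrite ell1_basis_norm mulr1.
apply: le_trans (_ : b * psum u M <= _); last by rewrite ler_wpM2l// ell1_psum_le.
rewrite (psum_cat _ NM) mulrDr ler_wpDl//.
  by rewrite mulr_ge0// sumr_ge0.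
rewrite mulr_sumr big_nat_cond [leRHS]big_nat_cond.
apply: ler_sum => k /andP[/andP[Nk _] _].
by rewrite linearZ/= [leLHS]normrM mulrC ler_wpM2r// phib.
Unshelve. all: by end_near. Qed.

(** For nearly disjoint supports the norms almost add up: the loss is controlled by the mass of [u]
    before [N] and the mass of [v] from [N] on. *)
Lemma ell1_normD_ge u v N :
  `|u| + `|v| <= `|u + v| + 2 * psum u N + 2 * (`|v| - psum v N).
Proof.
suff : `|u| <= `|u + v| + 2 * psum u N + `|v| - 2 * psum v N by lra.
apply: ell1_norm_le => M.
wlog NM : M / (N <= M)%N.
  move=> h; have [/h//|/ltnW MN] := leqP N M.
  by apply: le_trans (h N (leqnn N)); exact: psum_mono.
have h1 : psum v N - psum u N <= psum (u + v) N.
  rewrite /psum -sumrB; apply: ler_sum => k _.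
  by rewrite lerBlDr; have := ler_normB (u k + v k) (u k); rewrite addrAC subrr add0r.
have h2 : (psum u M - psum u N) - (psum v M - psum v N) <=
    psum (u + v) M - psum (u + v) N.
  have tl (w : ell1 R) : psum w M - psum w N = \sum_(N <= k < M) `|w k|.
    by rewrite (psum_cat w NM) addrAC subrr add0r.
  rewrite !tl -sumrB; apply: ler_sum => k _; rewrite lerBlDr.
  by have := ler_normB (u k + v k) (v k); rewrite addrK.
have := ell1_psum_le v M; have := ell1_psum_le (u + v) M.
by lra.
Qed.

Lemma cvg_ler T (F : set_system T) (f g : T -> R) (l l' : R) : ProperFilter F ->
  f @ F --> l -> g @ F --> l' -> (\forall t \near F, f t <= g t) -> l <= l'.
Proof.
move=> FF fl gl fg; rewrite -subr_ge0; apply: (cvgr_to_ge (cvgB gl fl)).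
by apply: filterS fg => t; rewrite -subr_ge0.
Qed.

Lemma psum_cvg T (F : set_system T) (u : T -> ell1 R) (z : nat -> R) N :
  ProperFilter F -> (forall k, (u t k : R^o) @[t --> F] --> (z k : R^o)) ->
  (psum (u t) N : R) @[t --> F] --> (\sum_(0 <= k < N) `|z k| : R).
Proof.
move=> FF uz; apply: (@cvg_big R^o _ +%R) => [|k _]; first exact: add_continuous.
exact: (cvg_norm (uz k)).
Qed.

Lemma psum_cvg0 T (F : set_system T) (u : T -> ell1 R) N : ProperFilter F ->
  (forall k, (u t k : R^o) @[t --> F] --> (0 : R^o)) ->
  (psum (u t) N : R) @[t --> F] --> (0 : R).
Proof.
move=> FF u0.
have -> : (0 : R) = \sum_(0 <= k < N) `|0 : R| by rewrite big1// => ? _; rewrite normr0.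
exact: (@psum_cvg T F u (fun=> 0) N FF u0).
Qed.

(** Asymptotic additivity of the l1 norm: [v] lives essentially on finitely many coordinates, where
    [u t] vanishes in the limit. The opposite inequality is the triangle inequality. *)
Lemma ell1_ultra_normD T (F : set_system T) (u : T -> ell1 R) v (L l : R) :
  ProperFilter F -> (forall k, (u t k : R^o) @[t --> F] --> (0 : R^o)) ->
  (`|u t| : R) @[t --> F] --> L -> (`|u t + v| : R) @[t --> F] --> l ->
  L + `|v| <= l.
Proof.
move=> FF u0 uL ul.
have psum0 N := psum_cvg0 N FF u0.
have le N : L + `|v| <= l + 2 * (`|v| - psum v N).
  have cl : `|u t + v| + 2 * psum (u t) N + 2 * (`|v| - psum v N) @[t --> F] -->
      (l + 2 * 0 + 2 * (`|v| - psum v N)).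
    exact: cvgD (cvgD ul (cvgMl_tmp (psum0 N))) (cvg_cst _).
  rewrite mulr0 addr0 in cl.
  apply: (cvg_ler _ (cvgD uL (cvg_cst `|v|)) cl).
  by near=> t; exact: ell1_normD_ge.
have cl : (l + 2 * `|ell1_tail N v|) @[N --> \oo] --> (l + 2 * 0).
  exact: cvgD (cvg_cst _) (cvgMl_tmp (ell1_tail_cvg v)).
rewrite mulr0 addr0 in cl.
by apply: (cvgr_to_ge cl); near=> N; rewrite ell1_tail_norm.
Unshelve. all: by end_near. Qed.

End ell1_theory.

(** * Extreme points and the constant rstar *)

Section ell1_extreme.
Context {R : realType}.
Implicit Types u v : ell1 R.

Lemma psum_remove u n M : (n < M)%N ->
  psum u M = `|u n| + psum (u - u n *: ell1_basis n) M.
Proof.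
move=> nM; set w := u - _; have E k : w k = u k - u n * (k == n)%:R.
  by rewrite -(ell1_basisE n k).
move: w E => w E.
rewrite /psum !big_mkord (bigD1 (Ordinal nM))//= [in RHS](bigD1 (Ordinal nM))//=.
rewrite E eqxx mulr1 subrr normr0 add0r; congr (_ + _); apply: eq_bigr => k.
by rewrite E -val_eqE /= => /negPf ->; rewrite mulr0 subr0.
Qed.

Lemma ell1_norm_remove u n : `|u - u n *: ell1_basis n| + `|u n| <= `|u|.
Proof.
rewrite -lerBrDr; apply: ell1_norm_le => M; rewrite lerBrDr addrC.
apply: le_trans (lerD (lexx _) (psum_mono _ (leq_maxl M n.+1))) _.
by rewrite -psum_remove ?leq_maxr// ell1_psum_le.
Qed.

Lemma ell1_basis_unique u n : `|u| <= 1 -> u n = 1 -> u = ell1_basis n.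
Proof.
move=> u1 un; have := le_trans (ell1_norm_remove u n) u1.
rewrite un scale1r normr1 -lerBrDr subrr normr_le0 subr_eq0.
by move/eqP.
Qed.

Lemma ell1_basis_extreme n : extreme_points (@unit_ball R (ell1 R)) (ell1_basis n).
Proof.
split=> [|y z t]; rewrite /unit_ball /=; first by rewrite ell1_basis_norm.
move=> y1 z1 /andP[t0 t1] E.
have : 1 = t * y n + (1 - t) * z n.
  by have := congr1 (fun u : ell1 R => u n) E; rewrite ell1_basisE eqxx.
have yn := le_trans (ler_norm _) (le_trans (ell1_coord_le y n) y1).
have zn := le_trans (ler_norm _) (le_trans (ell1_coord_le z n) z1).
move=> h; split; apply: ell1_basis_unique => //; apply/eqP; rewrite eq_le.
  by rewrite yn /= -(ler_pM2l t0); nra.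
rewrite zn /= -(@ler_pM2l _ (1 - t)) ?subr_gt0//; nra.
Qed.

Lemma ell1_extreme_basis u : extreme_points (@unit_ball R (ell1 R)) u ->
  exists n, exists2 s : R, `|s| = 1 & u = s *: ell1_basis n.
Proof.
move=> [u1 ext]; rewrite /unit_ball /= in u1 ext.
have [u0|] := pselect (u = 0).
  have [//||||E _] := ext (ell1_basis 0) (- ell1_basis 0) 2^-1.
  - by rewrite ell1_basis_norm.
  - by rewrite normrN ell1_basis_norm.
  - by lra.
  - by rewrite u0 scalerN -scalerBl (_ : 2^-1 - _ = 0) ?scale0r//; lra.
  have := @ell1_basis_norm R 0%N; rewrite E u0 normr0 => /esym/eqP.
  by rewrite oner_eq0.
move=> u0; have [n un] : exists n, u n != 0.
  apply: contrapT => h; apply: u0; apply: ell1_ext => k.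
  by apply: contrapT => /eqP uk; apply: h; exists k.
exists n; have := ell1_norm_remove u n.
set w := u - _; set a := `|u n| => aw.
have a0 : 0 < a by rewrite normr_gt0.
have uE : u = w + u n *: ell1_basis n by rewrite subrK.
have [a1|a1] := eqVneq a 1.
  exists (u n) => //.
  have : `|w| <= 0 by rewrite a1 in aw; lra.
  by rewrite normr_le0 => /eqP w0; rewrite {1}uE w0 add0r.
have a1' : a < 1 by rewrite lt_neqAle a1; have := normr_ge0 w; lra.
(* For [a < 1], [u] is a convex combination, with weight [a], of a signed basis vector and the
   rescaled remainder; extremality identifies it with the former. *)
exists (u n / a); first by rewrite normrM normfV normr_id divff// gt_eqF.
have [||||E _] := ext ((u n / a) *: ell1_basis n) ((1 - a)^-1 *: w) a.
- by rewrite normrZ normrM normfV normr_id divff ?gt_eqF// mul1r ell1_basis_norm.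
- by rewrite normrZ normfV gtr0_norm ?subr_gt0// ler_pdivrMl ?subr_gt0//; lra.
- by rewrite a0.
- have a1n : 1 - a != 0 by rewrite subr_eq0 gt_eqF.
  by rewrite !scalerA mulrC divfK ?gt_eqF// divff// scale1r addrC.
- exact: esym.
Qed.

End ell1_extreme.

Lemma extreme_points_isometry {R : realType} (V W : normedModType R)
    (f : {linear V -> W}) (g : {linear W -> V}) x :
  cancel f g -> cancel g f -> (forall x, `|f x| = `|x|) ->
  extreme_points (@unit_ball R V) x -> extreme_points (@unit_ball R W) (f x).
Proof.
move=> fK gK fn [x1 ext]; split; rewrite /unit_ball/= ?fn//.
have gn y : `|g y| = `|y| by rewrite -fn gK.
move=> y z t y1 z1 t01 E.
have [||||gy gz] := ext (g y) (g z) t; rewrite /unit_ball/= ?gn//.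
  by rewrite -!linearZ -linearD -E fK.
by split; [rewrite -gy gK|rewrite -gz gK].
Qed.

(** * Weak-star cluster points of the extreme points in a predual of l1 *)

Section predual.
Context {R : realType} {X : completeNormedModType R}.

Lemma weak_star_nbhs (g : dual X) (x : X) (e : R) : 0 < e ->
  nbhs (g : weak_star X) [set h : dual X | `|h x - g x| < e].
Proof.
move=> e0; have /weak_star_cvgP/(_ x) := @cvg_id (weak_star X) (nbhs (g : weak_star X)).
by move=> /cvgrPdistC_lt/(_ e e0).
Qed.

Lemma weak_star_nbhs_neq (f g : dual X) : f != g ->
  nbhs (g : weak_star X) [set h : dual X | h != f].
Proof.
move=> fg; have [x fgx] : exists x, f x != g x.
  apply: contrapT => h; move/eqP : fg; apply; apply/val_inj/funext => x.
  by apply: contrapT => /eqP fx; apply: h; exists x.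
have := @weak_star_nbhs g x `|f x - g x|; rewrite normr_gt0 subr_eq0 => /(_ fgx).
by apply: filterS => h /=; apply: contraTneq => ->; rewrite ltxx.
Qed.

(** Weak-star lower semicontinuity of the norm. *)
Lemma weak_star_cluster_norm (A : set (dual X)) (M : R) g :
  (forall h, A h -> `|h| <= M) -> weak_star_cluster A g -> `|g| <= M.
Proof.
move=> AM Ag; rewrite leNgt; apply/negP => /dual_norm_gt[x x1 Mx].
have [|h [_ Ah]] := Ag [set h : dual X | `|h x - g x| < g x - M].
  by apply: weak_star_nbhs; rewrite subr_gt0.
rewrite /= ltr_norml => /andP[h1 _].
have := dual_le_norm h x; have := ler_norm (h x); have := AM _ Ah.
have : `|h| * `|x| <= `|h| by rewrite ler_piMr.
lra.
Qed.

Lemma le_rstar (g : dual X) :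
  weak_star_cluster (extreme_points (@unit_ball R (dual X))) g -> `|g| <= rstar X.
Proof.
move=> Eg; apply: ub_le_sup; last by exists g.
by exists 1 => _ [h Eh <-]; apply: weak_star_cluster_norm Eh => f [].
Qed.

Lemma rstar_le1 : rstar X <= 1.
Proof.
rewrite /rstar; set S := [set _ | _ in _].
(* Without cluster points the supremum takes its default value 0. *)
have [S0|] := pselect (S !=set0); last by move/nonemptyPn => ->; rewrite sup0.
apply: ge_sup => // _ [h Eh <-].
by apply: weak_star_cluster_norm Eh => f [].
Qed.

Lemma rstar_ge0 : 0 <= rstar X.
Proof.
rewrite /rstar; set S := [set _ | _ in _].
have [[_ [g Eg _]]|] := pselect (S !=set0); last by move/nonemptyPn => ->; rewrite sup0.
exact: le_trans (normr_ge0 g) (le_rstar Eg).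
Qed.

Variables (J : {linear dual X -> ell1 R}) (P : {linear ell1 R -> dual X}).
Hypotheses (JK : cancel J P) (PK : cancel P J) (Jn : forall f, `|J f| = `|f|).

Let Pn u : `|P u| = `|u|. Proof. by rewrite -Jn PK. Qed.

Definition coordinate_functional k := P (ell1_basis k).
Local Notation e_ := coordinate_functional.

Lemma coordinate_functional_norm k : `|e_ k| = 1.
Proof. by rewrite Pn ell1_basis_norm. Qed.

Lemma coordinate_functional_le k x : `|e_ k x| <= `|x|.
Proof. by rewrite -[leRHS]mul1r -(coordinate_functional_norm k) dual_le_norm. Qed.

Lemma coordinate_functional_inj : injective e_.
Proof.
move=> i j /(congr1 J); rewrite !PK => /(congr1 (fun u : ell1 R => u i)).
by rewrite !ell1_basisE eqxx; case: eqVneq => // _ /eqP; rewrite oner_eq0.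
Qed.

Lemma coordinate_functional_extreme k :
  extreme_points (@unit_ball R (dual X)) (e_ k).
Proof. exact: (extreme_points_isometry PK JK Pn (ell1_basis_extreme k)). Qed.

Lemma extreme_coordinate_functional h : extreme_points (@unit_ball R (dual X)) h ->
  exists k, exists2 s : R, `|s| = 1 & h = s *: e_ k.
Proof.
move=> /(extreme_points_isometry JK PK Jn)/ell1_extreme_basis[k [s s1 E]].
by exists k, s => //; rewrite -[h]JK E linearZ.
Qed.

Lemma predual_functional_le (x : X) (b : R) N u : 0 <= b ->
  (forall k, (N <= k)%N -> `|e_ k x| <= b) ->
  `|P u x| <= `|x| * psum u N + b * `|u|.
Proof.
move=> b0 eb.
have lP : linear (fun u => P u x : R^o) by move=> a v w; rewrite linearP.
pose phi : {linear ell1 R -> R^o} := HB.pack (fun u => P u x : R^o)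
  (GRing.isLinear.Build _ _ _ _ _ lP).
apply: (@ell1_functional_le _ phi) => // v /=.
by rewrite mulrC -Pn dual_le_norm.
Qed.

(** Otherwise an ultrafilter limit of the offending [e_ k] would be a cluster point whose value at
    [x] is too large. Evaluation at [x], seen as a bounded sequence acting on l1, thus has size at
    most [rstar X * |x|] at infinity. *)
Lemma coordinate_functional_limsup (x : X) (e : R) : 0 < e ->
  exists N, forall k, (N <= k)%N -> `|e_ k x| <= rstar X * `|x| + e.
Proof.
move=> e0; apply: contrapT => h.
have [|F [FU FA Foo]] := @free_ultrafilter [set k | rstar X * `|x| + e < `|e_ k x|].
  move=> N; apply: contrapT => hN; apply: h; exists N => k Nk.
  by rewrite leNgt; apply/negP => ?; apply: hN; exists k.
have [|g g1 Fg] := @dual_ultra_limit R X _ F e_ 1 FU.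
  by move=> k; rewrite coordinate_functional_norm.
have Cg : weak_star_cluster (extreme_points (@unit_ball R (dual X))) g.
  have Fg' : e_ @ F --> (g : weak_star X) by exact/weak_star_cvgP.
  move=> U /Fg' FU'; have FUk : F [set k | U (e_ k)] := FU'.
  (* A cluster point must be approached by points other than itself; if [g] is some [e_ k0],
     injectivity of [e_] lets an index beyond [k0] serve. *)
  have [[k0 gk0]|ng] := pselect (exists k, g = e_ k).
    have Fk : F [set k | (k0 < k)%N] by apply: Foo; exists k0.+1.
    have [k [Uk k0k]] := filter_ex (filterI FUk Fk).
    exists (e_ k); split => //; last exact: coordinate_functional_extreme.
    by rewrite gk0 (inj_eq coordinate_functional_inj) gtn_eqF.
  have [k Uk] := filter_ex FUk; exists (e_ k); split => //.
    by apply/eqP => E; apply: ng; exists k.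
  exact: coordinate_functional_extreme.
have : rstar X * `|x| + e <= `|g x|.
  apply: (cvgr_to_ge (cvg_norm (Fg x))).
  by apply: filterS FA => k /ltW.
apply/negP; rewrite -ltNge; apply: le_lt_trans (dual_le_norm g x) _.
by rewrite ltr_pwDr// ler_wpM2r// le_rstar.
Qed.

End predual.

(** * Fixed points of nonexpansive maps: the case rstar < 1 *)

Lemma ell1_ultra_limit {R : realType} T (F : set_system T) (u : T -> ell1 R) (M : R) :
  UltraFilter F -> (forall t, `|u t| <= M) ->
  exists z : ell1 R, forall k, (u t k : R^o) @[t --> F] --> (z k : R^o).
Proof.
move=> FU uM.
have /choice[z uz] k : exists l : R^o, (u t k : R^o) @[t --> F] --> l.
  apply: (@ultra_bounded_cvg R T F FU (fun t => u t k) M).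
  by near=> t; exact: le_trans (ell1_coord_le _ _) (uM t).
have [|w wz] := @ell1_of R z M; last by exists w => k; rewrite wz.
move=> n; have cz := psum_cvg (N := n) (@ultra_proper _ _ FU) uz.
apply: (cvgr_to_le cz); near=> t.
exact: le_trans (ell1_psum_le _ _) (uM t).
Unshelve. all: by end_near. Qed.

Section approximate_fixed_points.
Context {R : realType} {E : normedModType R}.
Variables (D : set E) (T : E -> E) (M : R).
Hypotheses (D0 : D !=set0) (DM : forall x, D x -> `|x| <= M)
  (cD : forall x y (t : R), D x -> D y -> 0 < t < 1 -> D (t *: x + (1 - t) *: y))
  (TD : forall x, D x -> D (T x))
  (Tn : forall x y, D x -> D y -> `|T x - T y| <= `|x - y|).

(* Picard iterates of the contraction [x |-> (1 - e) T x + e x0]. *)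
Lemma approximate_fixed_point (del : R) : 0 < del ->
  exists2 x, D x & `|T x - x| <= del.
Proof.
move=> del0; have [x0 Dx0] := D0.
have M0 : 0 <= M by apply: le_trans (DM Dx0).
(* The anchor [x0] displaces an iterate by at most [e * (2 * M)], which is to be at most half of
   [del]; [M + 1] keeps the denominator positive. *)
pose e := Num.min 2^-1 (del / (4 * (M + 1))).
have M1 : 0 < 4 * (M + 1) by lra.
have e0 : 0 < e by rewrite lt_min; apply/andP; split; [lra|exact: divr_gt0].
have e1 : e <= 2^-1 by rewrite ge_min lexx.
have eM : e * (2 * M) <= del / 2.
  have : e <= del / (4 * (M + 1)) by rewrite ge_min lexx orbT.
  by rewrite ler_pdivlMr//; nra.
pose y := fix y n := if n is k.+1 then (1 - e) *: T (y k) + e *: x0 else x0.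
have Dy n : D (y n).
  elim: n => //= n Dn; rewrite -[e in e *: x0](subKr 1).
  apply: cD => //; [exact: TD|lra].
have step n : `|y n.+1 - y n| <= (1 - e) ^+ n * (2 * M).
  elim: n => [|n IH].
    rewrite expr0 mul1r; apply: le_trans (ler_normB _ _) _.
    by have := DM (Dy 1%N); have := DM (Dy 0%N); lra.
  have -> : y n.+2 - y n.+1 = (1 - e) *: (T (y n.+1) - T (y n)).
    by rewrite [y n.+2]/= [y n.+1 in X in _ - X]/= opprD addrACA subrr addr0 scalerBr.
  rewrite normrZ ger0_norm; last by lra.
  rewrite exprS -mulrA ler_wpM2l//; first by lra.
  exact: le_trans (Tn (Dy _) (Dy _)) IH.
have [n hn] : exists n, (1 - e) ^+ n * (2 * M) <= del / 2.
  have c0 : ((1 - e) ^+ n * (2 * M)) @[n --> \oo] --> (0 * (2 * M)).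
    apply: cvgMr_tmp; apply: cvg_expr; rewrite ger0_norm; lra.
  rewrite mul0r in c0.
  have [N _ hN] : \forall n \near \oo, (1 - e) ^+ n * (2 * M) <= del / 2.
    by apply: (cvgr_le _ c0); lra.
  by exists N; apply: hN => /=.
exists (y n) => //.
have -> : T (y n) - y n = (y n.+1 - y n) + e *: (T (y n) - x0).
  rewrite [y n.+1]/= scalerBr [e *: _ - _]addrC addrA [_ - y n - _]addrAC addrK.
  by rewrite addrAC -scalerDl subrK scale1r.
apply: le_trans (ler_normD _ _) _.
rewrite normrZ gtr0_norm//.
have : `|T (y n) - x0| <= 2 * M.
  apply: le_trans (ler_normB _ _) _.
  by have := DM (TD (Dy n)); have := DM Dx0; lra.
move/(ler_wpM2l (ltW e0)); have := step n; lra.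
Qed.

End approximate_fixed_points.

(** * Contraction of the asymptotic radius *)

Section weak_star_fixed_point.
Context {R : realType} {Y : completeNormedModType R}.
Variables (J : {linear dual Y -> ell1 R}) (d r : R) (U : set_system nat).
Variables (C : set (dual Y)) (T : dual Y -> dual Y).
Context {UU : UltraFilter U}.
Hypotheses (Uoo : \oo `<=` U) (J_le : forall f, `|J f| <= `|f|)
  (J_ge : forall f, `|f| <= d * `|J f|)
  (r0 : 0 <= r) (d0 : 0 < d) (dr : d * (1 + r) < 2)
  (C0 : C !=set0) (cvxC : convex_set C) (cC : compact (C : set (weak_star Y)))
  (TC : forall x, C x -> C (T x))
  (Tn : forall x y, C x -> C y -> `|T x - T y| <= `|x - y|)
  (limC : forall (h : nat -> dual Y) (z : ell1 R) (L : R) (g : dual Y),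
     (forall t, C (h t)) ->
     (forall k, (J (h t) k : R^o) @[t --> U] --> (z k : R^o)) ->
     (`|J (h t) - z| : R) @[t --> U] --> L ->
     (forall y, (h t y : R^o) @[t --> U] --> (g y : R^o)) -> `|J g - z| <= r * L).

Let convexC x y (t : R) : C x -> C y -> 0 < t < 1 -> C (t *: x + (1 - t) *: y).
Proof.
move=> Cx Cy /andP[t0 t1].
have := cvxC (Itv01 (ltW t0) (ltW t1)) (mem_set Cx) (mem_set Cy).
by rewrite inE.
Qed.

Let CM : exists M, forall x, C x -> `|x| <= M.
Proof. exact: weak_star_compact_bounded. Qed.

(** [z] need not be the image of a point of [C]; [L] is the asymptotic distance of an approximate
    fixed point sequence from its coordinatewise limit. *)
Let state (z : ell1 R) (L : R) := exists h : nat -> dual Y, [/\ (forall t, C (h t)),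
  (`|T (h t) - h t| : R) @[t --> U] --> (0 : R),
  (forall k, (J (h t) k : R^o) @[t --> U] --> (z k : R^o)) &
  (`|J (h t) - z| : R) @[t --> U] --> L].

(** Asking only for approximate fixed points lets [D] be any nonempty convex invariant part of [C];
    the boundedness of [C] makes the limits along [U] exist. *)
Let state_in (D : set (dual Y)) : D `<=` C -> D !=set0 ->
  (forall x y (t : R), D x -> D y -> 0 < t < 1 -> D (t *: x + (1 - t) *: y)) ->
  (forall x, D x -> D (T x)) ->
  exists (h : nat -> dual Y) (z : ell1 R) (L : R), [/\ (forall t, D (h t)),
  (`|T (h t) - h t| : R) @[t --> U] --> (0 : R),
  (forall k, (J (h t) k : R^o) @[t --> U] --> (z k : R^o)) &
  (`|J (h t) - z| : R) @[t --> U] --> L].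
Proof.
move=> DC D0 cD TD; have [M CleM] := CM.
have /choice[h hP] n : exists x, D x /\ `|T x - x| <= n.+1%:R^-1.
  have [||||||x Dx xT] // := @approximate_fixed_point R _ D T M _ _ _ _ _ (n.+1%:R^-1).
  - by move=> x /DC; exact: CleM.
  - by move=> x y /DC ? /DC; exact: Tn.
  - by exists x.
have [z zh] : exists z : ell1 R, forall k, (J (h t) k : R^o) @[t --> U] --> (z k : R^o).
  apply: (@ell1_ultra_limit R _ U (fun t => J (h t)) M) => t.
  by apply: le_trans (J_le _) _; apply: CleM; apply: DC; case: (hP t).
have [L Lh] : exists L : R^o, `|J (h t) - z| @[t --> U] --> L.
  apply: (@ultra_bounded_cvg R _ U UU (fun t => `|J (h t) - z|) (M + `|z|)).
  near=> t; rewrite normr_id; apply: le_trans (ler_normB _ _) _.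
  rewrite lerD2r; apply: le_trans (J_le _) _; apply: CleM; apply: DC.
  by case: (hP t).
exists h, z, L; split => //; first by move=> t; case: (hP t).
apply/cvgrPdist_le => e e0; apply: Uoo.
near=> n; rewrite sub0r normrN normr_id; case: (hP n) => _ /le_trans; apply.
by apply/ltW; near: n; exact: (near_infty_natSinv_lt (PosNum e0)).
Unshelve. all: by end_near. Qed.

Let state_step z L : state z L ->
  exists z' L', state z' L' /\ L' + `|z' - z| <= (d * (1 + r) - 1) * L.
Proof.
move=> [h [Ch Th zh Lh]]; have [M CleM] := CM.
have L0 : 0 <= L by apply: (cvgr_to_ge Lh); near=> t.
(* The bound on the limit is written with a slack [e], so that convexity and invariance can be
   checked index by index. *)
pose D := [set y : dual Y | C y /\ forall e, 0 < e ->
  \forall t \near U, `|h t - y| <= d * (1 + r) * L + e].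
have [] := @state_in D.
- by move=> y [].
(* The weak-star limit [g] lies in [D]: by [limC] its image is within [r * L] of [z], and returning
   from l1 to [dual Y] costs the factor [d]. *)
- have [g Cg gh] := weak_star_compact_limit UU cC Ch.
  exists g; split => // e e0.
  have gL := limC Ch zh Lh gh.
  have e1 : L < L + e / d by rewrite ltrDl divr_gt0.
  have Lh' := cvgr_le _ Lh _ e1.
  near=> t.
  apply: le_trans (J_ge _) _; rewrite linearB/=.
  have : `|J (h t) - J g| <= `|J (h t) - z| + `|J g - z|.
    by rewrite -[X in `|X|](subrKA z) [`|J g - z|]distrC; exact: ler_normD.
  have : `|J (h t) - z| <= L + e / d by near: t; exact: Lh'.
  move=> h1 h2.
  have h3 : `|J (h t) - J g| <= (1 + r) * L + e / d.
    by rewrite mulrDl mul1r addrAC; exact: le_trans h2 (lerD h1 gL).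
  apply: le_trans (ler_wpM2l (ltW d0) h3) _.
  by rewrite mulrDr mulrA [d * (e / d)]mulrC divfK ?gt_eqF.
- move=> x y t [Cx Dx] [Cy Dy] t01; split; first exact: convexC.
  move=> e e0; case/andP : (t01) => t0 t1.
  apply: filterS2 (Dx e e0) (Dy e e0) => n xn yn.
  have -> : h n - (t *: x + (1 - t) *: y) = t *: (h n - x) + (1 - t) *: (h n - y).
    by rewrite !scalerBr addrACA -scalerDl [t + _]addrC subrK scale1r -opprD.
  apply: le_trans (ler_normD _ _) _; rewrite !normrZ gtr0_norm// gtr0_norm ?subr_gt0//.
  by nra.
- move=> x [Cx Dx]; split; first exact: TC.
  move=> e e0; have e2 : 0 < e / 2 by lra.
  have Th' := cvgr_le _ Th _ e2.
  have Dx2 := Dx _ e2; near=> n.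
  have h1 : `|T (h n) - h n| <= e / 2 by near: n; exact: Th'.
  have h2 : `|h n - x| <= d * (1 + r) * L + e / 2 by near: n; exact: Dx2.
  rewrite -[X in `|X|](subrKA (T (h n))); apply: le_trans (ler_normD _ _) _.
  rewrite distrC [e]splitr addrCA; exact: lerD h1 (le_trans (Tn (Ch n) Cx) h2).
move=> h' [z' [L' [Dh' Th' zh' Lh']]].
exists z', L'; split.
  by exists h'; split => // t; case: (Dh' t).
have h0 k : ((J (h t) - z) k : R^o) @[t --> U] --> (0 : R^o).
  rewrite -[X in _ --> X](subrr (z k : R^o)).
  exact: (cvgB (zh k) (cvg_cst _)).
have h'0 k : ((J (h' t) - z') k : R^o) @[t --> U] --> (0 : R^o).
  rewrite -[X in _ --> X](subrr (z' k : R^o)).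
  exact: (cvgB (zh' k) (cvg_cst _)).
(* Asymptotic additivity splits [L] off the radius: [L + |z - J (h' m)|] is at most
   [d * (1 + r) * L]. *)
have key m : `|J (h' m) - z| <= (d * (1 + r) - 1) * L.
  have [Ch'm Dm] := Dh' m.
  have [l lE] : exists l : R^o, `|J (h t) - z + (z - J (h' m))| @[t --> U] --> l.
    apply: (@ultra_bounded_cvg R _ U UU (fun t => `|J (h t) - z + (z - J (h' m))|) (M +
      M)).
    near=> t; rewrite normr_id subrKA; apply: le_trans (ler_normB _ _) _.
    by apply: lerD; apply: le_trans (J_le _) _; apply: CleM.
  rewrite distrC mulrBl mul1r lerBrDl.
  apply: le_trans (ell1_ultra_normD _ h0 Lh lE) _.
  apply/ler_addgt0Pr => e e0; apply: (cvgr_to_le lE).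
  apply: filterS (Dm e e0) => t; apply: le_trans.
  by rewrite subrKA -linearB; exact: J_le.
(* The same additivity, now along [h'], turns the uniform bound [key] into one on
   [L' + |z' - z|]. *)
have [l lE] : exists l : R^o, `|J (h' t) - z' + (z' - z)| @[t --> U] --> l.
  apply: (@ultra_bounded_cvg R _ U UU (fun t => `|J (h' t) - z' + (z' - z)|) ((d * (1 +
    r) - 1) * L)).
  by near=> t; rewrite normr_id subrKA.
apply: le_trans (ell1_ultra_normD _ h'0 Lh' lE) _.
by apply: (cvgr_to_le lE); near=> t; rewrite subrKA.
Unshelve. all: by end_near. Qed.

Lemma weak_star_fixed_point : exists2 x, C x & T x = x.
Proof.
have kap1 : d * (1 + r) - 1 < 1 by rewrite ltrBlDr; exact: dr.
have [h [z0 [L0 [Ch Th zh Lh]]]] := state_in (@subset_refl _ C) C0 convexC TC.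
have st0 : state z0 L0 by exists h.
have /choice[nxt nxtP] (s : {s : ell1 R * R | state s.1 s.2}) :
    exists s' : {s : ell1 R * R | state s.1 s.2},
    (sval s').2 + `|(sval s').1 - (sval s).1| <= (d * (1 + r) - 1) * (sval s).2.
  have [z' [L' [st' le']]] := state_step (svalP s).
  by exists (exist _ (z', L') st').
pose s := fix s n := if n is k.+1 then nxt (s k)
  else exist (fun s : ell1 R * R => state s.1 s.2) (z0, L0) st0.
pose z n := (sval (s n)).1; pose L n := (sval (s n)).2.
have st n : state (z n) (L n) := svalP (s n).
have step n : L n.+1 + `|z n.+1 - z n| <= (d * (1 + r) - 1) * L n := nxtP (s n).
have L_ge0 n : 0 <= L n.
  by case: (st n) => h' [_ _ _ Lh']; apply: (cvgr_to_ge Lh'); near=> t.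
set kap := d * (1 + r) - 1 in kap1 step *.
(* Since [kap < 1], each jump of [z] is paid for by a decrease of [L], and the decreases
   telescope. *)
have tele n m : `|z (n + m)%N - z n| <= L n - L (n + m)%N.
  elim: m => [|m IH]; first by rewrite addn0 !subrr normr0.
  rewrite addnS -[X in `|X|](subrKA (z (n + m)%N)).
  apply: le_trans (ler_normD _ _) _.
  by have := step (n + m)%N; have := L_ge0 (n + m)%N; nra.
have Lcvg : L n @[n --> \oo] --> (0 : R).
  pose k' := Num.max kap 0.
  have Lk n : 0 <= L n <= k' ^+ n * L0.
    rewrite L_ge0/=; elim: n => [|n IH]; first by rewrite mul1r.
    have h1 : L n.+1 <= kap * L n by have := step n; have := normr_ge0 (z n.+1 - z n);
      lra.
    apply: le_trans h1 _; rewrite exprS -mulrA.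
    apply: le_trans (_ : k' * L n <= _).
      by rewrite ler_wpM2r// le_max lexx.
    by rewrite ler_wpM2l// le_max lexx orbT.
  have c0 : (k' ^+ n * L0) @[n --> \oo] --> (0 * L0).
    apply: cvgMr_tmp; apply: cvg_expr; rewrite ger0_norm ?le_max ?lexx ?orbT//.
    by rewrite gt_max kap1 ltr01.
  rewrite mul0r in c0.
  apply: (squeeze_cvgr _ (cvg_cst 0) c0).
  by near=> n; exact: Lk.
(* A diagonal choice: one point of the n-th sequence that is both nearly fixed and nearly at
   distance [L n] from [z n]. *)
have /choice[y yP] n : exists y, [/\ C y, `|T y - y| <= n.+1%:R^-1 &
    `|J y - z n| <= L n + n.+1%:R^-1].
  have [h' [Ch' Th' _ Lh']] := st n.
  have n0 : (0 : R) < n.+1%:R^-1 by rewrite invr_gt0.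
  have n1 : L n < L n + n.+1%:R^-1 by rewrite ltrDl.
  have [t [h1 h2]] := filter_ex (filterI (cvgr_le _ Th' _ n0) (cvgr_le _ Lh' _ n1)).
  by exists (h' t).
have Cy n : C (y n) by case: (yP n).
(* A weak-star limit is taken in order to stay in [C]; the Cauchy estimate [yc] passes to it
   pointwise and upgrades the convergence to norm convergence. *)
have [x Cx xy] := weak_star_compact_limit UU cC Cy.
pose c n := d * (3 * L n + 2 * n.+1%:R^-1).
have c0 : c n @[n --> \oo] --> (0 : R).
  rewrite -[X in _ --> X](mulr0 d) -[X in _ --> d * X](addr0 0).
  rewrite -[X in _ --> d * (X + _)](mulr0 3) -[X in _ --> d * (_ + X)](mulr0 2).
  apply: cvgMl_tmp; apply: cvgD; apply: cvgMl_tmp => //.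
  exact: cvg_harmonic.
have yc n m : `|y (n + m)%N - y n| <= c n.
  apply: le_trans (J_ge _) _; rewrite linearB /c ler_wpM2l ?(ltW d0)//.
  have [_ _ h1] := yP n; have [_ _ h2] := yP (n + m)%N; have h3 := tele n m.
  have h4 : (n + m).+1%:R^-1 <= n.+1%:R^-1 :> R.
    by rewrite lef_pV2 ?posrE// ler_nat ltnS leq_addr.
  rewrite -[X in `|X|](subrKA (z n)) -[X in `|X + _|](subrKA (z (n + m)%N)).
  rewrite distrC in h1.
  apply: le_trans (ler_normD _ _) _.
  apply: le_trans (lerD (le_trans (ler_normD _ _) (lerD h2 h3)) h1) _.
  move: h4 (L_ge0 n); move: (n.+1%:R^-1) (_.+1%:R^-1) (L n) (L _) => a b Ln Lm.
  by rewrite -subr_ge0; lra.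
have xc n : `|x - y n| <= c n.
  apply: dual_norm_le => [|v].
    by apply: le_trans (yc n 0%N).
  have cv : (`|y m v - y n v| : R) @[m --> U] --> (`|x v - y n v| : R).
    exact: cvg_norm (cvgB (xy v) (cvg_cst _)).
  apply: (cvgr_to_le cv); apply: Uoo; exists n => // m /= nm.
  rewrite -(subnKC nm).
  apply: le_trans (dual_le_norm (y (n + (m - n))%N - y n) v) _.
  by rewrite ler_wpM2r.
exists x => //; apply/eqP; rewrite -subr_eq0 -normr_le0.
have c1 : (2 * c n + n.+1%:R^-1) @[n --> \oo] --> (0 : R).
  rewrite -[X in _ --> X](addr0 0) -[X in _ --> X + _](mulr0 2).
  by apply: cvgD; [exact: cvgMl_tmp|exact: cvg_harmonic].
apply: (cvgr_to_ge c1); near=> n.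
have [_ h1 _] := yP n; have h2 := xc n.
have h3 := le_trans (Tn Cx (Cy n)) h2; rewrite distrC in h2.
rewrite -[X in `|X|](subrKA (y n)) -[X in `|X + _|](subrKA (T (y n))).
apply: le_trans (ler_normD _ _) _; apply: le_trans (lerD (ler_normD _ _) h2) _.
by rewrite mulr_natl mulr2n [leRHS]addrAC; exact: (lerD (lerD h3 h1) (lexx _)).
Unshelve. all: by end_near. Qed.

End weak_star_fixed_point.

Lemma isometry_inverse {R : realType} (V W : normedModType R) :
  isometrically_isomorphic V W -> exists (J : {linear V -> W}) (P : {linear W -> V}),
    [/\ cancel J P, cancel P J & forall x, `|J x| = `|x|].
Proof.
move=> [J [[g gK Kg] Jn]].
have lg : linear g by move=> a x y; rewrite -[x in LHS]Kg -[y in LHS]Kg -linearP gK.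
pose P : {linear W -> V} := HB.pack g (GRing.isLinear.Build _ _ _ _ _ lg).
by exists J, P.
Qed.

Lemma dual_precomp {R : realType} (X Y : normedModType R) (T : {linear X -> Y}) :
  continuous T -> exists A : {linear dual Y -> dual X},
    forall f x, A f x = f (T x).
Proof.
move=> cT.
have /choice[A AE] (f : dual Y) : exists g : dual X, forall x, g x = f (T x).
  apply: (@dual_of R X (fun x => f (T x)) (`|f| * opnorm T)).
    by move=> a x y; rewrite !linearP.
  move=> x; apply: le_trans (dual_le_norm _ _) _.
  by rewrite -mulrA ler_wpM2l// ler_opnorm.
have lA : linear A.
  move=> a f g; apply/val_inj/funext => x /=; rewrite AE.
  by rewrite -[RHS]/(a *: A f x + A g x) !AE.
pose A' : {linear dual Y -> dual X} := HB.pack A (GRing.isLinear.Build _ _ _ _ _ lA).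
by exists A'.
Qed.

Lemma opnorm_ge0 {R : realType} (V W : normedModType R) (T : {linear V -> W}) :
  continuous T -> 0 <= opnorm T.
Proof.
by move=> cT; apply: le_trans (opnorm_ge (x := 0) cT _); rewrite ?normr0.
Qed.

Theorem rstar_lt1_stable {R : realType} (X : completeNormedModType R) :
  isometrically_isomorphic (dual X) (ell1 R) -> rstar X < 1 ->
  stable_weak_star_fpp X.
Proof.
move=> hX r1; have [J [P [JK PK Jn]]] := isometry_inverse hX.
have Pn u : `|P u| = `|u| by rewrite -Jn PK.
have r0 := @rstar_ge0 R X; set r := rstar X in r0 r1 *.
(* The condition [d * (1 + r) < 2] solved for [d]. *)
exists (2 / (1 + r)); first by rewrite ltr_pdivlMr; lra.
move=> Y /ereal_inf_lt[_ [T [S [cT cS TK SK ->]]]]; rewrite lte_fin => TS.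
move=> C C0 cvxC cC F nF.
have [A AE] := dual_precomp cT.
have TS1 : 1 <= opnorm T * opnorm S.
  have [x _ ex] : exists2 x, `|x| <= 1 & 2^-1 < P (ell1_basis 0) x.
    by apply: dual_norm_gt; rewrite Pn ell1_basis_norm; lra.
  have x0 : 0 < `|x|.
    by rewrite normr_gt0; apply: contraTneq ex => ->; rewrite linear0 -leNgt; lra.
  rewrite -(ler_pM2r x0) mul1r -{1}[x]TK mulrC mulrA mulrC.
  apply: le_trans (ler_opnorm _ cS) _; rewrite ler_wpM2l ?opnorm_ge0//.
  by rewrite mulrC; exact: ler_opnorm.
have T0 : 0 < opnorm T.
  by rewrite lt_neqAle opnorm_ge0// andbT; apply: contraTneq TS1 => <-;
    rewrite mul0r -ltNge.
(* Dividing the adjoint by [opnorm T] makes [JY] norm-decreasing and moves the whole distortion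
   [opnorm T * opnorm S] into [JY_ge]. *)
pose J' := fun f : dual Y => (opnorm T)^-1 *: J (A f).
have lJ' : linear J'.
  move=> a f g; by rewrite /J' (linearP A) (linearP J) scalerDr !scalerA mulrC.
pose JY : {linear dual Y -> ell1 R} := HB.pack J' (GRing.isLinear.Build _ _ _ _ _ lJ').
have [U [UU _ Uoo]] := @free_ultrafilter setT (fun N => ex_intro2 _ _ N (leqnn N) I).
(* Tested at [x], the coordinatewise null sequence [JY (h t) - z] meets in the limit only the far
   values [e_ k x], which are at most [r * |x|] up to an error. *)
have limC (h : nat -> dual Y) (z : ell1 R) (L : R) (g : dual Y) :
    (forall t, C (h t)) ->
    (forall k, (JY (h t) k : R^o) @[t --> U] --> (z k : R^o)) ->
    (`|JY (h t) - z| : R) @[t --> U] --> L ->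
    (forall y, (h t y : R^o) @[t --> U] --> (g y : R^o)) -> `|JY g - z| <= r * L.
  move=> Ch zh Lh gh; rewrite -Pn.
  have L0 : 0 <= L by apply: (cvgr_to_ge Lh); near=> t.
  have u0 k : ((JY (h t) - z) k : R^o) @[t --> U] --> (0 : R^o).
    rewrite -[X in _ --> X](subrr (z k : R^o)).
    exact: (cvgB (zh k) (cvg_cst _)).
  apply: dual_norm_le => [|x]; first exact: mulr_ge0.
  have Px f : P (JY f - z) x = (opnorm T)^-1 * f (T x) - P z x.
    by rewrite linearB/= linearZ/= JK -AE.
  have cx : (`|P (JY (h t) - z) x| : R) @[t --> U] --> (`|P (JY g - z) x| : R).
    apply: cvg_norm; rewrite Px.
    rewrite (_ : (fun t => _) = (fun t => (opnorm T)^-1 * h t (T x) - P z x)).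
      exact: cvgB (cvgMl_tmp (gh (T x))) (cvg_cst _).
    by apply/funext => t; rewrite Px.
  rewrite mulrAC; apply/ler_addgt0Pr => e e0.
  (* Scaled so that the error remains below [e] after multiplication by the limit norm [L]. *)
  have e1 : 0 < e / (L + 1) by apply: divr_gt0 => //; lra.
  have [N hN] := @coordinate_functional_limsup R X J P JK PK Jn x _ e1.
  have b0 : 0 <= rstar X * `|x| + e / (L + 1).
    exact: addr_ge0 (mulr_ge0 r0 (normr_ge0 x)) (ltW e1).
  have cb : (`|x| * psum (JY (h t) - z) N + (r * `|x| + e / (L + 1)) * `|JY (h t) - z|)
    @[t --> U]
      --> (`|x| * 0 + (r * `|x| + e / (L + 1)) * L).
    by apply: cvgD; apply: cvgMl_tmp => //; exact: psum_cvg0.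
  have : `|P (JY g - z) x| <= `|x| * 0 + (r * `|x| + e / (L + 1)) * L.
    apply: (cvg_ler _ cx cb).
    by near=> t; exact: (predual_functional_le PK Jn _ b0 hN).
  rewrite mulr0 add0r mulrDl => /le_trans; apply.
  rewrite lerD2l mulrAC ler_pdivrMr; last lra.
  by rewrite ler_wpM2l ?ltW//; lra.
have JY_le f : `|JY f| <= `|f|.
  rewrite normrZ normfV gtr0_norm// Jn ler_pdivrMl//.
  apply: opnorm_le => x x1; rewrite AE; apply: le_trans (dual_le_norm _ _) _.
  rewrite mulrC ler_wpM2r//; apply: le_trans (ler_opnorm _ cT) _.
  by rewrite ler_piMr// ltW.
have JY_ge f : `|f| <= opnorm T * opnorm S * `|JY f|.
  rewrite normrZ normfV gtr0_norm// Jn mulrAC mulrA divff ?gt_eqF// mul1r.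
  apply: opnorm_le => y y1; rewrite -[y]SK -AE.
  apply: le_trans (dual_le_norm _ _) _; rewrite ler_wpM2l//.
  apply: le_trans (ler_opnorm _ cS) _.
  by rewrite ler_piMr// opnorm_ge0.
apply: (@weak_star_fixed_point R Y JY (opnorm T * opnorm S) r U C F UU) => //.
- exact: lt_le_trans ltr01 TS1.
- by rewrite -ltr_pdivlMr//; lra.
- by move=> x Cx; exact: funS.
- by move=> x y Cx Cy; apply: nF; rewrite inE.
Unshelve. all: by end_near. Qed.

(** * Almost isometric copies of c: the case rstar = 1 *)

Section finite_helly.
Context {R : realType} {X : normedModType R}.
Variables (n : nat) (v : 'I_n -> X) (xi : {linear dual X -> R^o}).
Variables (f1 f2 : dual X) (rho rho' eta : R).
Hypotheses (rho0 : 0 <= rho') (rhoP : rho' < rho) (eta0 : 0 < eta).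
Hypothesis xiP : forall i (h : dual X), `|h (v i) - 2 * xi h| <= rho' * `|h|.

Let V := (('I_n -> X) * (R^o * R^o))%type.

Let pmax (w : 'I_n -> X) : R := \big[Num.max/0]_i `|w i|.

Let pmax_le w M : 0 <= M -> (forall i, `|w i| <= M) -> pmax w <= M.
Proof. by move=> M0 wM; apply: bigmax_le => // i _. Qed.

Let le_pmax w i : `|w i| <= pmax w.
Proof. exact: le_bigmax. Qed.

Let pmax_ge0 w : 0 <= pmax w.
Proof. by rewrite /pmax; elim/big_rec : _ => // i x _ x0; rewrite le_max x0 orbT. Qed.

(** The weight for which [p w < rho] forces both scalar entries below [eta]. *)
Let K := rho / eta.

Let p (w : V) : R := pmax w.1 + K * (`|w.2.1| + `|w.2.2|).

Let K0 : 0 < K. Proof. by apply: divr_gt0 => //; exact: le_lt_trans rhoP. Qed.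

Let p_ge0 w : 0 <= p w.
Proof. by apply: addr_ge0 => //; apply: mulr_ge0; [exact: ltW|exact: addr_ge0]. Qed.

Let sp : sublinear p.
Proof.
split=> [w w'|t w t0].
  rewrite /p addrACA -mulrDr; apply: lerD.
    apply: pmax_le => [|i]; first exact: addr_ge0.
    by apply: le_trans (ler_normD _ _) _; apply: lerD.
  by rewrite ler_wpM2l ?(ltW K0)// addrACA; apply: lerD; exact: ler_normD.
rewrite /p [leRHS]mulrDr; apply: lerD.
  apply: pmax_le => [|i]; first by rewrite mulr_ge0// ltW.
  by rewrite /= normrZ gtr0_norm// ler_wpM2l// ltW.
by rewrite /= !normrM gtr0_norm// -mulrDr mulrCA.
Qed.

(** [pt 1 x] collects the defects of a candidate [x]; the parameter [t] homogenizes this affine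
    family, whose directions are the [pt 0 x]. *)
Let pt (t : R) (x : X) : V := (fun i => t *: v i - 2 *: x, (f1 x - t * xi f1, f2 x - t
  * xi f2)).

Let ptD t s x y : pt (t + s) (x + y) = pt t x + pt s y.
Proof.
congr (_, (_, _)).
- by apply/funext => i /=; rewrite scalerDl scalerDr opprD addrACA.
- by rewrite /= linearD mulrDl opprD addrACA.
- by rewrite /= linearD mulrDl opprD addrACA.
Qed.

Let ptZ a t x : pt (a * t) (a *: x) = a *: pt t x.
Proof.
congr (_, (_, _)).
- apply/funext => i /=; rewrite -[RHS]/(a *: (t *: v i - 2 *: x)).
  by rewrite scalerBr !scalerA [2 * a]mulrC.
- by rewrite /= linearZ -mulrA -mulrBr.
- by rewrite /= linearZ -mulrA -mulrBr.
Qed.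

(** A case of local reflexivity: in the bidual every [v i - 2 xi] has norm at most [rho'], and [x]
    imitates [xi]. If no [x] did, a linear functional below [p] and at least [rho] on all [pt 1 x]
    would exist; evaluating it gives [rho <= rho']. *)
Lemma finite_helly : exists x, [/\ forall i, `|v i - 2 *: x| < rho,
  `|f1 x - xi f1| < eta & `|f2 x - xi f2| < eta].
Proof.
apply: contrapT => hx.
have p1 x : rho <= p (pt 1 x).
  rewrite leNgt; apply/negP => px; apply: hx; exists x.
  have h1 := pmax_ge0 (pt 1 x).1.
  have h2 : 0 <= K * (`|(pt 1 x).2.1| + `|(pt 1 x).2.2|).
    by apply: mulr_ge0; [exact: ltW|exact: addr_ge0].
  split.
  - move=> i; have := le_pmax (pt 1 x).1 i; rewrite /pt /= scale1r => /le_lt_trans; apply.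
    by apply: le_lt_trans px; rewrite lerDl.
  - rewrite -(ltr_pM2l K0) {2}/K divfK ?gt_eqF//; apply: le_lt_trans px.
    apply: le_trans (_ : K * (`|(pt 1 x).2.1| + `|(pt 1 x).2.2|) <= _);
      last by rewrite lerDr.
    by rewrite ler_wpM2l ?(ltW K0)// /pt /= !mul1r lerDl.
  - rewrite -(ltr_pM2l K0) {2}/K divfK ?gt_eqF//; apply: le_lt_trans px.
    apply: le_trans (_ : K * (`|(pt 1 x).2.1| + `|(pt 1 x).2.2|) <= _);
      last by rewrite lerDr.
    by rewrite ler_wpM2l ?(ltW K0)// /pt /= !mul1r lerDr.
pose S := [set a : V * R | exists t x, 0 <= t /\ a = (pt t x, t * rho)].
have [||phi [phip Sphi]] := @mazur_orlicz R V p S sp.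
- split.
  + exists 0, 0; split => //; rewrite mul0r; congr (_, _).
    by have := ptZ 0 0 0; rewrite mul0r !scale0r.
  + move=> _ _ [t [x [t0 ->]]] [s [y [s0 ->]]]; exists (t + s), (x + y).
    by split; [exact: addr_ge0|rewrite ptD mulrDl].
  + move=> a _ a0 [t [x [t0 ->]]]; exists (a * t), (a *: x).
    by split; [rewrite mulr_ge0// ltW|rewrite ptZ mulrA].
- move=> _ [t [x [t0 ->]]] /=; move: t0; rewrite le_eqVlt => /predU1P[<-|t0].
    by rewrite mul0r.
  have -> : pt t x = t *: pt 1 (t^-1 *: x).
    by rewrite -ptZ mulr1 scalerA divff ?gt_eqF// scale1r.
  by rewrite (sublinearZ _ sp t0) ler_wpM2l// ltW.
pose single i (x : X) : 'I_n -> X := fun j => if j == i then x else 0.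
have singleD i a x y : single i (a *: x + y) = a *: single i x + single i y.
  apply/funext => j; rewrite /single -[RHS]/(a *: (if j == i then x else 0) + (if j ==
    i then y else 0)).
  by case: eqP => // _; rewrite scaler0 addr0.
have /choice[H HE] i : exists h : dual X, forall x, h x = phi (single i x, 0).
  apply: (@dual_of R X (fun x => phi (single i x, 0)) 1).
    move=> a x y; rewrite singleD -[RHS]/(a *: phi _ + _) -linearP; congr (phi _).
    rewrite [RHS](_ : _ = (a *: single i x + single i y, a *: 0 + 0))//.
    by rewrite scaler0 addr0.
  have le x : phi (single i x, 0) <= `|x|.
    apply: le_trans (phip _) _; rewrite /p /= normr0 addr0 mulr0 addr0.
    by apply: pmax_le => // j; rewrite /single; case: eqP; rewrite ?normr0.
  move=> x; rewrite mul1r ler_norml le andbT lerNl.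
  rewrite -linearN -[`|x|]normrN; apply: le_trans (le (- x)).
  rewrite le_eqVlt; apply/orP; left; apply/eqP; congr (phi (_, _)); last by rewrite oppr0.
  by apply/funext => j; rewrite /single -[LHS]/(- (if j == i then x else 0));
    case: eqP; rewrite ?oppr0.
pose al := phi (0, (1, 0)); pose be := phi (0, (0, 1)).
have phiE w a b : phi (w, (a, b)) = \sum_i H i (w i) + al * a + be * b.
  have -> : (w, (a, b)) = \sum_i (single i (w i), 0) + a *: (0, (1, 0)) + b *: (0, (0,
    1)) :> V.
    have -> : \sum_i ((single i (w i), 0) : V) = (w, 0).
      have {2}-> : w = \sum_i single i (w i).
        apply/funext => j; rewrite fct_sumE (bigD1 j)//= /single eqxx big1 ?addr0// => i.
        by rewrite eq_sym => /negPf ->.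
      by elim/big_rec2 : _ => // i a' b' _ ->; rewrite -[LHS]/(_ + _, 0 + 0) addr0.
    congr (_, (_, _)).
    - by rewrite /= !scaler0 !addr0.
    - by rewrite /= scaler0 addr0 add0r [LHS](_ : a = a *: (1 : R^o)) // [RHS]mulr1.
    - by rewrite /= scaler0 addr0 add0r [b *: _]mulr1.
  rewrite !linearD linear_sum !linearZ/= (mulrC al) (mulrC be); congr (_ + _ + _).
  by apply: eq_bigr => i _; rewrite HE.
(* On the directions [pt 0 x] the functional [phi] is nonnegative, for [x] and for [- x], hence
   zero. *)
have ker x : al * f1 x + be * f2 x = 2 * \sum_i H i x.
  have ge0 y : 0 <= al * f1 y + be * f2 y - 2 * \sum_i H i y.
    have := Sphi (pt 0 y, 0 * rho) (ex_intro _ 0 (ex_intro _ y (conj (lexx 0) erefl))).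
    rewrite /= mul0r /pt phiE !mul0r !subr0.
    have -> : \sum_i H i (0 *: v i - 2 *: y) = - (2 * \sum_i H i y).
      rewrite mulr_sumr -sumrN; apply: eq_bigr => i _.
      by rewrite scale0r sub0r linearN linearZ.
    by rewrite -addrA addrC.
  apply/eqP; rewrite -subr_eq0 eq_le ge0 andbT -oppr_ge0.
  have := ge0 (- x).
  have -> : \sum_i H i (- x) = - \sum_i H i x.
    by rewrite -sumrN; apply: eq_bigr => i _; rewrite linearN.
  by rewrite !linearN !mulrN -opprD -opprD.
(* The sum norm is dual to the maximum norm: [phi] is tested on a tuple of nearly norming vectors.
   The divisor [n.+1] also covers [n = 0]. *)
have sumH : \sum_i `|H i| <= 1.
  apply/ler_addgt0Pr => e e0.
  have d0 : 0 < e / n.+1%:R by apply: divr_gt0.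
  have /choice[x xP] i : exists x, `|x| <= 1 /\ `|H i| - e / n.+1%:R <= H i x.
    have [|x x1 Hx] := @dual_norm_gt _ _ (H i) (`|H i| - e / n.+1%:R).
      by rewrite ltrBlDr ltrDl.
    by exists x; split => //; exact: ltW.
  have : \sum_i (`|H i| - e / n.+1%:R) <= 1.
    apply: le_trans (_ : \sum_i H i (x i) <= _).
      by apply: ler_sum => i _; case: (xP i).
    have := phiE x 0 0; rewrite !mulr0 !addr0 => <-.
    apply: le_trans (phip _) _; rewrite /p /= !normr0 addr0 mulr0 addr0.
    by apply: pmax_le => // i; case: (xP i).
  rewrite sumrB lerBlDr => /le_trans; apply; rewrite lerD2l.
  rewrite sumr_const card_ord -[_ *+ n]mulr_natr mulrAC ler_pdivrMr//.
  by rewrite ler_wpM2l ?(ltW e0)// ler_nat.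
have Heq : al *: f1 + be *: f2 = 2 *: \sum_i H i.
  apply/val_inj/funext => x /=; rewrite -[LHS]/(al * f1 x + be * f2 x) ker.
  rewrite -[RHS]/(2 * (\sum_i H i) x); congr (_ * _).
  by elim/big_rec2 : _ => // i a b _ ->.
have := Sphi (pt 1 0, 1 * rho) (ex_intro _ 1 (ex_intro _ 0 (conj ler01 erefl))).
rewrite /= mul1r /pt phiE => le_rho.
suff : rho <= rho' by rewrite leNgt rhoP.
apply: le_trans le_rho _.
(* Applying [xi] to [Heq] turns the two scalar terms into the sum of the [2 * xi (H i)], after which
   the hypothesis on [xi] applies to each [H i]. *)
apply: le_trans (_ : \sum_i (H i (v i) - 2 * xi (H i)) <= _).
  have E : al * xi f1 + be * xi f2 = 2 * \sum_i xi (H i).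
    have := congr1 xi Heq; rewrite linearD !linearZ/= => ->.
    by rewrite linear_sum.
  rewrite sumrB -mulr_sumr -E.
  rewrite !linear0 !sub0r !mul1r !mulrN opprD addrA.
  rewrite le_eqVlt; apply/orP; left; apply/eqP; congr (_ - _ - _).
  by apply: eq_bigr => i _; rewrite scale1r ?scaler0 ?oppr0 ?subr0 ?addr0.
apply: le_trans (_ : \sum_i rho' * `|H i| <= _).
  by apply: ler_sum => i _; apply: le_trans (ler_norm _) _.
by rewrite -mulr_sumr ler_piMr.
Qed.

End finite_helly.

(** * Recursive construction of the sign system *)

Section sign_system.
Context {R : realType} {X : completeNormedModType R}.
Variables (J : {linear dual X -> ell1 R}) (P : {linear ell1 R -> dual X}).
Hypotheses (JK : cancel J P) (PK : cancel P J) (Jn : forall f, `|J f| = `|f|).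
Variables (eps : R) (g : dual X).
Hypotheses (eps0 : 0 < eps) (eps1 : eps <= 1)
  (Eg : weak_star_cluster (extreme_points (@unit_ball R (dual X))) g).

Local Notation e_ := (coordinate_functional P).

Lemma weak_star_near_seq (V : seq X) (del : R) : 0 < del ->
  \forall h \near (g : weak_star X), forall v, v \in V -> `|(h : dual X) v - g v| < del.
Proof.
move=> del0; elim: V => [|v V IH]; first by near=> h.
apply: filterS2 (weak_star_nbhs g v del0) IH => h h1 h2 w.
by rewrite inE => /predU1P[->//|]; exact: h2.
Unshelve. all: by end_near. Qed.

(** This forces extreme points found near [g] to have a large index. Real scalars of modulus 1 leave
    two functionals per index to avoid; one of them may be [g], whence the condition [h != g]. *)
Lemma weak_star_near_basis K : \forall h \near (g : weak_star X),
  (h : dual X) != g -> forall k, (k < K)%N -> forall s : R, `|s| = 1 -> h <> s *: e_ k.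
Proof.
elim: K => [|K IH]; first by near=> h.
have far s : \forall h \near (g : weak_star X), (h : dual X) != g -> h != s *: e_ K.
  have [<-|sg] := eqVneq (s *: e_ K) g; first by near=> h.
  by apply: filterS (weak_star_nbhs_neq sg).
have f1 := far 1; have f2 := far (-1).
apply: filterS3 IH f1 f2 => h h1 h2 h3 hg k.
rewrite ltnS leq_eqVlt => /predU1P[->|kK]; last exact: h1.
move=> s s1; have [s0|s0] := leP 0 s.
  by rewrite -(ger0_norm s0) s1; apply/eqP; exact: h2.
by rewrite -[s]opprK -(ltr0_norm s0) s1; apply/eqP; exact: h3.
Unshelve. all: by end_near. Qed.

(** The bound at [g] is the invariant of the recursion: the value of [v] at an extreme point near
    [g] is then close to 1, and subtracting 2 from it lands near -1. *)
Definition admissible (v : X) := `|v| < 1 + eps /\ 1 - eps < g v.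

Lemma admissible_slack (V : seq X) : (forall v, v \in V -> admissible v) ->
  exists2 del : R, 0 < del <= 1 & forall v, v \in V -> `|v| <= 1 + eps - del /\ 1 - eps
    + del <= g v.
Proof.
elim: V => [|v V IH] gV; first by exists 1; rewrite ?ltr01 ?lexx.
have [w wV|del /andP[d0 d1] hd] := IH; first by apply: gV; rewrite inE wV orbT.
have [v1 v2] := gV v (mem_head _ _).
pose a : R := Num.min del (Num.min (1 + eps - `|v|) (g v - (1 - eps))).
have a1 : a <= del by rewrite ge_min lexx.
exists a; first by rewrite !lt_min d0 !subr_gt0 v1 v2 (le_trans a1).
have a2 : a <= 1 + eps - `|v| by rewrite !ge_min lexx orbT.
have a3 : a <= g v - (1 - eps) by rewrite !ge_min lexx !orbT.
move=> w; rewrite inE => /predU1P[->|/hd]; first by split; lra.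
by move=> [h1 h2]; split; lra.
Qed.

(** The vector to imitate is the signed unit vector [xi] of the bidual at the index [k] of an
    extreme point [h] near [g]. Passing from [v] to [v - 2 xi] changes only coordinate [k],
    essentially by a sign, while [xi g] is small because [J g k] is; so admissibility survives. *)
Lemma sign_step (V : seq X) : (forall v, v \in V -> admissible v) ->
  exists x (f : dual X), [/\ `|f| <= 1, 1 - eps < f x &
    forall v, v \in V -> admissible (v - 2 *: x)].
Proof.
move=> gV; have e0 := eps0; have e1 := eps1; have [del /andP[d0 del1] hd] :=
  admissible_slack gV.
have d2 : 0 < del / 2 by lra.
have d8 : 0 < del / 8 by lra.
have [K hK] : exists K, forall k, (K <= k)%N -> `|J g k| < del / 8.
  have := ell1_tail_cvg (J g) => /cvgr_lt/(_ _ d8)[K _ hK].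
  exists K.
  move=> k Kk; apply: le_lt_trans (hK K (leqnn K)).
  have := ell1_coord_le (ell1_tail K (J g)) k.
  by rewrite ell1_tailE ltnNge Kk.
have [h [hg Eh [hV hf]]] := Eg (filterI (weak_star_near_seq V d2) (weak_star_near_basis
  K)).
have [k [s s1 hE]] := extreme_coordinate_functional JK PK Jn Eh.
have Kk : (K <= k)%N.
  by rewrite leqNgt; apply/negP => kK; exact: (hf hg k kK s s1).
have ss : s * s = 1 by rewrite -expr2 -real_normK ?num_real// s1 expr1n.
have lxi : linear (fun f : dual X => s * J f k : R^o).
  by move=> a f f'; rewrite linearP -[LHS]/(s * (a * J f k + J f' k)) mulrDr mulrCA.
pose xi : {linear dual X -> R^o} := HB.pack (fun f : dual X => s * J f k : R^o)
  (GRing.isLinear.Build _ _ _ _ _ lxi).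
have h1 : `|h| <= 1 by case: Eh.
have hx : xi h = 1.
  rewrite /xi/= hE linearZ PK -[LHS]/(s * (s * ell1_basis k k)) ell1_basisE eqxx mulr1.
  exact: ss.
have gx : `|xi g| < del / 8 by rewrite /xi/= normrM s1 mul1r hK.
have rho'0 : 0 <= 1 + eps - del / 2 by lra.
have bnd (i : 'I_(size V)) (f : dual X) : `|f (nth 0 V i) - 2 * xi f| <= (1 + eps - del
  / 2) * `|f|.
  set v := nth 0 V i; have vV : v \in V by exact: mem_nth.
  have [nv gv] := hd v vV.
  have lphi : linear (fun u : ell1 R => P u v - 2 * (s * u k) : R^o).
    move=> a u w; rewrite linearP.
    rewrite -[LHS]/(a * P u v + P w v - 2 * (s * (a * u k + w k))).
    rewrite -[RHS]/(a * (P u v - 2 * (s * u k)) + (P w v - 2 * (s * w k))).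
    by ring.
  pose phi : {linear ell1 R -> R^o} := HB.pack (fun u : ell1 R => P u v - 2 * (s * u k)
    : R^o)
    (GRing.isLinear.Build _ _ _ _ _ lphi).
  (* With [N = 0] the head sum is empty: the norm of [phi] is read off its values at basis
     vectors. *)
  have := @ell1_functional_le R phi (`|v| + 2) (1 + eps - del / 2) 0 (J f).
  rewrite /phi /= JK /psum big_geq// mulr0 add0r Jn; apply => //.
  - move=> u; apply: le_trans (ler_normB _ _) _; rewrite [leRHS]mulrDl; apply: lerD.
      by apply: le_trans (dual_le_norm _ _) _; rewrite -Jn PK mulrC.
    by rewrite !normrM s1 mul1r ger0_norm// ler_wpM2l// ell1_coord_le.
  - move=> j _; rewrite ell1_basisE.
    have [<-|kj] := eqVneq k j; last first.
      rewrite !mulr0 subr0; apply: le_trans (coordinate_functional_le PK Jn _ _) _.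
      by lra.
    have -> : P (ell1_basis k) v - 2 * (s * true%:R) = s * (h v - 2).
      have -> : h v = s * P (ell1_basis k) v by rewrite hE.
      by rewrite mulrBr [s * (s * _)]mulrA ss mul1r mulr1 [s * 2]mulrC.
    rewrite normrM s1 mul1r.
    have hv : `|h v - g v| < del / 2 by exact: hV.
    have hv1 : h v <= `|v|.
      apply: le_trans (ler_norm _) _; apply: le_trans (dual_le_norm _ _) _.
      by rewrite ler_piMl.
    move: hv; rewrite ltr_norml => /andP[h2 h3].
    by rewrite ler_norml; apply/andP; split; lra.
have e8 : 0 < Num.min eps (del / 8) by rewrite lt_min eps0 d8.
have rhoP : 1 + eps - del / 2 < 1 + eps by lra.
have [x [xV xh xg]] := finite_helly h g rho'0 rhoP e8 bnd.
exists x, h; split => //.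
  move: xh; rewrite hx lt_min ltr_norml => /andP[/andP[xh _] _]; lra.
move=> v vV; split.
  by have := xV (Ordinal (etrans (index_mem v V) vV)); rewrite /= nth_index.
move: xg; rewrite lt_min => /andP[_ xg].
have [_ gv] := hd v vV.
rewrite linearB linearZ/=.
have : g x <= xi g + `|g x - xi g|.
  by rewrite -lerBlDl; exact: ler_norm.
have := ler_norm (xi g).
rewrite -[2 *: g x]/(2 * g x).
lra.
Qed.

End sign_system.

(** The list of admissible vectors doubles at each step, one half for each value of [b n]. The same
    [eps] serves throughout, because finitely many strict inequalities always leave a slack. *)
Lemma sign_system {R : realType} (X : completeNormedModType R) (eps : R) :
  isometrically_isomorphic (dual X) (ell1 R) -> rstar X = 1 ->
  0 < eps -> eps <= 1 ->
  exists (x0 : X) (x : nat -> X) (f : nat -> dual X),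
    [/\ forall k, `|f k| <= 1, forall k, 1 - eps < f k (x k) &
    forall (b : nat -> bool) n,
      `|x0 - 2 *: \sum_(0 <= j < n) (b j)%:R *: x j| <= 1 + eps].
Proof.
move=> hX r1 e0 e1; have [J [P [JK PK Jn]]] := isometry_inverse hX.
have [g Eg ge] : exists2 g : dual X,
    weak_star_cluster (extreme_points (@unit_ball R (dual X))) g & 1 - eps < `|g|.
  have hs : has_sup [set `|g| | g in weak_star_cluster (extreme_points (@unit_ball R
    (dual X)))].
    apply: contrapT => /sup_out; rewrite -/(rstar X) r1 => /eqP.
    by rewrite oner_eq0.
  have [_ [g Eg <-] hg] := sup_adherent e0 hs.
  by exists g => //; move: hg; rewrite -/(rstar X) r1.
have [x0 x01 gx0] := dual_norm_gt ge.
pose gd (V : seq X) := forall v, v \in V -> admissible eps g v.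
have /choice[nxt nxtP] (s : {V | gd V}) : exists xf : X * dual X, [/\ `|xf.2| <= 1,
    1 - eps < xf.2 xf.1 & forall v, v \in sval s -> admissible eps g (v - 2 *: xf.1)].
  have [x [f [h1 h2 h3]]] := sign_step JK PK Jn e0 e1 Eg (svalP s).
  by exists (x, f).
have gd0 : gd [:: x0].
  move=> v; rewrite inE => /eqP ->; split => //.
  by apply: le_lt_trans x01 _; rewrite ltrDl.
have gdS (s : {V | gd V}) : gd (sval s ++ [seq v - 2 *: (nxt s).1 | v <- sval s]).
  move=> v; rewrite mem_cat => /orP[|/mapP[w wV ->]]; first exact: (svalP s).
  by case: (nxtP s) => _ _; exact.
pose s := fix s n := if n is k.+1 then exist gd _ (gdS (s k)) else exist gd _ gd0.
exists x0, (fun k => (nxt (s k)).1), (fun k => (nxt (s k)).2); split.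
- by move=> k; case: (nxtP (s k)).
- by move=> k; case: (nxtP (s k)).
move=> b n; suff h : x0 - 2 *: \sum_(0 <= j < n) (b j)%:R *: (nxt (s j)).1 \in sval (s n).
  by have [/ltW] := svalP (s n) _ h.
elim: n => [|n IH]; first by rewrite big_geq// scaler0 subr0 mem_head.
rewrite big_nat_recr//= mem_cat scalerDr opprD addrA; case: (b n).
  by apply/orP; right; rewrite scale1r; apply: map_f.
by rewrite scale0r scaler0 subr0 IH.
Qed.

(** * Embedding c by means of a sign system *)

Section c_theory.
Context {R : realType}.
Implicit Types u v : c_space R.

Lemma c_coord_le u n : `|u n| <= `|u|.
Proof.
apply: ub_le_sup; last by exists n.
have [M [_ uM]] := cvg_seq_bounded (c_cvg (u := u)).
by exists (M + 1) => _ [k _ <-]; apply: uM => //; rewrite ltrDl.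
Qed.

Lemma c_norm_le u (M : R) : (forall n, `|u n| <= M) -> `|u| <= M.
Proof.
move=> uM; apply: ge_sup; first by exists `|u 0%N|; exists 0%N.
by move=> _ [n _ <-].
Qed.

Definition c_lim u : R := limn (u : nat -> R^o).

Lemma c_lim_cvg u : (u n : R^o) @[n --> \oo] --> (c_lim u : R^o).
Proof. exact: (c_cvg (u := u)). Qed.

Lemma c_limP a u v : c_lim (a *: u + v) = a * c_lim u + c_lim v.
Proof.
apply: cvg_lim => //.
exact: (cvgD (cvgMl_tmp (@c_lim_cvg u)) (@c_lim_cvg v)).
Qed.

Lemma c_lim_le u : `|c_lim u| <= `|u|.
Proof.
apply: (cvgr_to_le (cvg_norm (@c_lim_cvg u))).
by near=> n; exact: c_coord_le.
Unshelve. all: by end_near. Qed.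

Lemma c_of (f : nat -> R^o) (l : R^o) : f @ \oo --> l ->
  exists u : c_space R, forall n, u n = f n.
Proof.
move=> fl; have cf : f \in @c_pred R by rewrite inE; exact: cvgP fl.
by exists (CSpace cf).
Qed.

End c_theory.

Section embedding.
Context {R : realType} {X : completeNormedModType R}.
Variables (rho : R) (x0 : X) (x : nat -> X).
Hypothesis signs : forall (b : nat -> bool) n,
  `|x0 - 2 *: \sum_(0 <= j < n) (b j)%:R *: x j| <= rho.

(* Choosing the signs [b] so that no cancellation occurs. *)
Lemma sign_functional (h : dual X) n : `|h| <= 1 ->
  `|h x0 - \sum_(0 <= j < n) h (x j)| + \sum_(0 <= j < n) `|h (x j)| <= rho.
Proof.
move=> h1; set a := h x0 - _.
have key (b : nat -> bool) : `|h x0 - 2 * \sum_(0 <= j < n) (b j)%:R * h (x j)| <= rho.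
  apply: le_trans (signs b n).
  have -> : h x0 - 2 * \sum_(0 <= j < n) (b j)%:R * h (x j) =
      h (x0 - 2 *: \sum_(0 <= j < n) (b j)%:R *: x j).
    rewrite [RHS]linearB/= [h (2 *: _)]linearZ/= [h (\sum_(_ <= _ < _) _)]linear_sum/=.
    congr (_ - 2 * _).
    by apply: eq_bigr => j _; rewrite linearZ.
  apply: le_trans (dual_le_norm _ _) _.
  by rewrite ler_piMl.
have E (b : nat -> bool) : h x0 - 2 * \sum_(0 <= j < n) (b j)%:R * h (x j) =
    a + \sum_(0 <= j < n) (1 - 2 * (b j)%:R) * h (x j).
  rewrite /a -addrA; congr (_ + _); rewrite mulr_sumr -!sumrN -big_split/=.
  by apply: eq_bigr => j _; ring.
have [a0|a0] := leP 0 a.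
  have := key (fun j => h (x j) < 0); rewrite E; apply: le_trans.
  rewrite (ger0_norm a0); apply: le_trans (ler_norm _); rewrite lerD2l.
  apply: ler_sum => j _; have [h0|h0] := ltP (h (x j)) 0.
    by rewrite ltr0_norm// mulr1 mulrBl mul1r mulr_natl mulr2n opprD addrA subrr sub0r.
  by rewrite ger0_norm// mulr0 subr0 mul1r.
have := key (fun j => 0 < h (x j)); rewrite E; apply: le_trans.
rewrite (ltr0_norm a0) -[leRHS]normrN [- (a + _)]opprD; apply: le_trans (ler_norm _);
  rewrite lerD2l -sumrN.
apply: ler_sum => j _; have [h0|h0] := ltP 0 (h (x j)).
  by rewrite gtr0_norm// mulr1 mulrBl mul1r mulr_natl mulr2n opprB addrK.
by rewrite ler0_norm// mulr0 subr0 mul1r.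
Qed.

Lemma norming_functional (y : X) : exists2 h : dual X, `|h| <= 1 & h y = `|y|.
Proof.
pose p := fun z : X => `|z|.
have sp : sublinear p.
  split=> [u v|t u t0]; first exact: ler_normD.
  by rewrite /p normrZ gtr0_norm.
pose S := [set (t *: y, t * `|y|) | t in [set t : R | 0 <= t]].
have [||phi [phip Sphi]] := @mazur_orlicz R X p S sp.
- split.
  + by exists 0; rewrite /= ?lexx// scale0r mul0r.
  + move=> _ _ [t /= t0 <-] [s /= s0 <-]; exists (t + s); first exact: addr_ge0.
    by rewrite scalerDl mulrDl.
  + move=> t _ t0 [s /= s0 <-]; exists (t * s); first by rewrite /= mulr_ge0// ltW.
    by rewrite scalerA mulrA.
- by move=> _ [t /= t0 <-] /=; rewrite /p normrZ ger0_norm.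
have phi1 z : `|phi z| <= 1 * `|z|.
  by rewrite mul1r ler_norml phip andbT lerNl -linearN -[`|z|]normrN; exact: phip.
have [h hE] := dual_of (linearP phi) phi1; exists h.
  by apply: dual_norm_le => // z; rewrite hE.
apply/eqP; rewrite eq_le hE phip/=.
have := Sphi (1 *: y, 1 * `|y|); rewrite /= scale1r mul1r; apply.
by exists 1; rewrite /= ?ler01// scale1r mul1r.
Qed.

(** The intended image of the sequence that agrees with [u] before [n] and is constantly [l] from
    [n] on. *)
Definition c_partial_sum (l : R) (u : nat -> R) n : X :=
  l *: x0 + \sum_(0 <= j < n) (u j - l) *: x j.

Lemma functional_partial_sum (h : dual X) l u n : h (c_partial_sum l u n) =
  l * (h x0 - \sum_(0 <= j < n) h (x j)) + \sum_(0 <= j < n) u j * h (x j).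
Proof.
rewrite /c_partial_sum [LHS]linearD/= [h (l *: _)]linearZ/=.
rewrite [h (\sum_(_ <= _ < _) _)]linear_sum/= mulrBr -addrA; congr (_ + _).
rewrite mulr_sumr -sumrN -big_split/=; apply: eq_bigr => j _.
by rewrite linearZ/= -[LHS]/((u j - l) * h (x j)) mulrBl addrC.
Qed.

Lemma partial_sum_le (l : R) (u : nat -> R) n (M : R) : 0 <= M -> `|l| <= M ->
  (forall j, `|u j| <= M) -> `|c_partial_sum l u n| <= M * rho.
Proof.
move=> M0 lM uM; have [h h1 <-] := norming_functional (c_partial_sum l u n).
apply: le_trans (ler_norm _) _; rewrite functional_partial_sum.
apply: le_trans (ler_wpM2l M0 (sign_functional n h1)); rewrite [leRHS]mulrDr.
apply: le_trans (ler_normD _ _) _; apply: lerD; first by rewrite normrM ler_wpM2r.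
apply: le_trans (ler_norm_sum _ _ _) _; rewrite mulr_sumr; apply: ler_sum => j _.
by rewrite normrM ler_wpM2r.
Qed.

(** By [sign_functional] the masses of [f] total at most [1 + eps], and the one at [k] exceeds
    [1 - eps], so the others total at most [2 * eps]; the third [eps] is lost in [f (x k)]
    itself. *)
Lemma partial_sum_ge (f : dual X) (eps : R) (l : R) (u : nat -> R) k n (M : R) :
  rho <= 1 + eps -> `|f| <= 1 -> 1 - eps < f (x k) -> (k < n)%N -> 0 <= M ->
  `|l| <= M -> (forall j, `|u j| <= M) ->
  `|u k| - 3 * eps * M <= `|c_partial_sum l u n|.
Proof.
move=> rho_le f1 fk kn M0 lM uM.
apply: (@le_trans _ _ `|f (c_partial_sum l u n)|); last first.
  by apply: le_trans (dual_le_norm _ _) _; rewrite ler_piMl.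
rewrite functional_partial_sum.
have := sign_functional n f1; set a := f x0 - _.
rewrite !big_mkord (bigD1 (Ordinal kn))//= [X in _ -> _ <= `|_ + X|](bigD1 (Ordinal
  kn))//=.
set s := \sum_(i | _) `|_|; set s' := \sum_(i | _) _ => H.
have s's : `|s'| <= M * s.
  apply: le_trans (ler_norm_sum _ _ _) _; rewrite mulr_sumr; apply: ler_sum => j _.
  by rewrite normrM ler_wpM2r.
have la : `|l * a| <= M * `|a| by rewrite normrM ler_wpM2r.
have tk := le_lt_trans (le_refl _) fk.
have tk1 := ler_norm (f (x k)).
have uk := uM k.
have uk0 := normr_ge0 (u k).
have tri (p q r : R) : `|p - q - r| <= `|p| + `|q| + `|r|.
  apply: le_trans (ler_normB _ _) _; rewrite lerD2r; exact: ler_normB.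
have h1 : `|u k * f (x k)| <= `|l * a + (u k * f (x k) + s')| + `|l * a| + `|s'|.
  have E : u k * f (x k) = (l * a + (u k * f (x k) + s')) - l * a - s' by ring.
  by rewrite [in leLHS]E; exact: tri.
rewrite normrM in h1.
have s0 : 0 <= s by apply: sumr_ge0.
have a0 := normr_ge0 a.
have h2 : `|u k| * (1 - eps) <= `|u k| * `|f (x k)| by rewrite ler_wpM2l//; lra.
have h3 : M * (`|a| + s) <= M * (2 * eps) by rewrite ler_wpM2l//; lra.
have eps0 : 0 <= eps by lra.
have h4 : `|u k| * eps <= M * eps by rewrite ler_wpM2r.
lra.
Qed.

End embedding.

Lemma bounded_below_embedding {R : realType} (V W : normedModType R)
    (U : {linear V -> W}) (c M : R) : 0 < c ->
  (forall x, c * `|x| <= `|U x|) -> (forall x, `|U x| <= M * `|x|) ->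
  isomorphic_embedding U.
Proof.
move=> c0 cU UM; split; first exact: bounded_linear_continuous UM.
have injU : injective U.
  move=> x y xy; apply/eqP; rewrite -subr_eq0 -normr_le0 -(pmulr_rle0 _ c0).
  by apply: le_trans (cU _) _; rewrite linearB xy subrr normr0.
have /choice[S SP] (y : W) : exists x, range U y -> U x = y.
  have [[x _ <-]|ny] := pselect (range U y); first by exists x.
  by exists 0.
have SU x : S (U x) = x by apply: injU; apply: SP; exists x.
exists S => //; apply/subspace_continuousP => _ [x _ <-].
apply/cvgrPdist_le => e e0; rewrite /from_subspace SU near_withinE.
have ec : 0 < c * e by exact: mulr_gt0.
near=> y => -[z _ zy]; rewrite -zy SU -(ler_pM2l c0); apply: le_trans (cU _) _.
rewrite linearB zy.
by near: y; exact: cvgr_dist_le (@cvg_id _ (nbhs (U x))) _ ec.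
Unshelve. all: by end_near. Qed.

Theorem rstar1_almost_isometric_copies {R : realType} (X : completeNormedModType R) :
  isometrically_isomorphic (dual X) (ell1 R) -> rstar X = 1 ->
  almost_isometric_copies_c X.
Proof.
(* [3 * eps] has to be at most [e], and below 1 for the map to be bounded below. *)
move=> hX r1 e e0; pose eps : R := Num.min e 1 / 6.
have m0 : 0 < Num.min e 1 by rewrite lt_min e0 ltr01.
have me : Num.min e 1 <= e by rewrite ge_min lexx.
have m1 : Num.min e 1 <= 1 by rewrite ge_min lexx orbT.
have eps0 : 0 < eps by rewrite divr_gt0.
have eps6 : 6 * eps = Num.min e 1 by rewrite mulrC divfK// pnatr_eq0.
have eps1 : eps <= 1 by lra.
have [x0 [x [f [f1 fx signs]]]] := sign_system hX r1 eps0 eps1.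
pose S (u : c_space R) n : X := c_partial_sum x0 x (c_lim u) u n.
have S_le (u : c_space R) n : `|S u n| <= `|u| * (1 + eps).
  by apply: (partial_sum_le signs); [|exact: c_lim_le|exact: c_coord_le].
have Scvg (u : c_space R) : cvgn (S u).
  have cw : cvgn (series (fun j => (u j - c_lim u) *: x j)).
    apply: cauchy_cvg; apply/cauchy_seriesP => d d0.
    have d1 : 0 < d / 4 by lra.
    have /cvgrPdistC_le/(_ _ d1)[N _ hN] := @c_lim_cvg R u.
    exists ([set n | (N <= n)%N], [set n | (N <= n)%N]) => /=; first by split; exists N.
    move=> [m n] /= [Nm Nn].
    have [mn|nm] := leqP m n; last by rewrite big_geq ?normr0// ltnW.
    (* A block of the series is a partial sum with limit 0 and coefficients cut off before [m], so
       [partial_sum_le] bounds it by the size of its coefficients. *)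
    pose w j : R := if (m <= j)%N then u j - c_lim u else 0.
    have wd j : `|w j| <= d / 4.
      rewrite /w; case: ifP => mj; last by rewrite normr0 ltW.
      by apply: hN; exact: leq_trans mj.
    have -> : \sum_(m <= k < n) (u k - c_lim u) *: x k = c_partial_sum x0 x 0 w n.
      rewrite /c_partial_sum scale0r add0r (big_cat_nat (leq0n m) mn)/=.
      rewrite [X in _ = X + _]big_nat_cond [X in _ = X + _]big1 ?add0r; last first.
        by move=> i /andP[/andP[_ im] _]; rewrite /w leqNgt im subr0 scale0r.
      rewrite [LHS]big_nat_cond [RHS]big_nat_cond;
        apply: eq_bigr => i /andP[/andP[mi _] _].
      by rewrite /w mi subr0.
    apply: le_lt_trans (partial_sum_le signs n (ltW d1) _ wd) _.
      by rewrite normr0 ltW.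
    have : d / 4 * (1 + eps) <= d / 4 * 2 by rewrite ler_wpM2l ?(ltW d1)//; lra.
    lra.
  exact: (is_cvgD (is_cvg_cst (c_lim u *: x0)) cw).
pose U u : X := limn (S u).
have lU : linear U.
  move=> a u v; apply: cvg_lim => //.
  rewrite (_ : S _ = (fun n => a *: S u n + S v n)); last first.
    apply/funext => n; rewrite /S /c_partial_sum c_limP scalerDl.
    rewrite [in RHS]scalerDr scalerA [RHS]addrACA; congr (_ + _).
    rewrite scaler_sumr -big_split/=; apply: eq_bigr => j _.
    rewrite scalerA -scalerDl; congr (_ *: _).
    by rewrite -[LHS]/((a * u j + v j) - (a * c_lim u + c_lim v)); ring.
  exact: (cvgD (cvgZr (Scvg u)) (Scvg v)).
pose U' : {linear c_space R -> X} := HB.pack U (GRing.isLinear.Build _ _ _ _ _ lU).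
have U_le u : `|U' u| <= (1 + eps) * `|u|.
  by apply: (cvgr_to_le (cvg_norm (Scvg u))); near=> n; rewrite mulrC.
have U_ge u : (1 - 3 * eps) * `|u| <= `|U' u|.
  rewrite mulrBl mul1r lerBlDr; apply: c_norm_le => k; rewrite -lerBlDr.
  apply: (cvgr_to_ge (cvg_norm (Scvg u))); near=> n.
  apply: (partial_sum_ge signs (lexx _) (f1 k) (fx k)) => //.
  - by near: n; exists k.+1.
  - exact: c_lim_le.
  - exact: c_coord_le.
exists U'; split.
  apply: (bounded_below_embedding _ U_ge U_le); lra.
move=> u; apply/andP; split.
  apply: le_trans (U_ge u); rewrite ler_wpM2r//; lra.
apply: le_trans (U_le u) _; rewrite ler_wpM2r//; lra.
Unshelve. all: by end_near. Qed.

(** * Failure of the fixed point property *)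

Section ell1_pairing.
Context {R : realType}.

Lemma ell1_pairing (b : nat -> R) (B : R) : (forall k, `|b k| <= B) ->
  exists phi : {linear ell1 R -> R^o}, forall u : ell1 R,
    (\sum_(0 <= k < n) u k * b k : R) @[n --> \oo] --> (phi u : R).
Proof.
move=> bB.
have /choice[phi phiP] (u : ell1 R) : exists l : R^o,
    (\sum_(0 <= k < n) u k * b k : R) @[n --> \oo] --> (l : R).
  have : cvgn (series (fun k => u k * b k : R^o)).
    apply: normed_cvg; apply: (@series_le_cvg _ _ (fun k => B * `|u k|)).
    - by move=> k; exact: normr_ge0.
    - by move=> k; apply: mulr_ge0 => //; exact: le_trans (bB 0%N).
    - by move=> k; rewrite [leLHS]normrM mulrC ler_wpM2r.
    - exact: (@is_cvg_seriesZ R (fun k => `|u k|) B (ell1_cvg (u := u))).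
  by move=> /cvg_ex[l ul]; exists l.
have lphi : linear phi.
  move=> a u v; apply: (cvg_unique _ (phiP _)) => //.
  rewrite (_ : (fun n => _) = (fun n => a * (\sum_(0 <= k < n) u k * b k) +
      \sum_(0 <= k < n) v k * b k)); last first.
    apply/funext => n; rewrite mulr_sumr -big_split/=; apply: eq_bigr => k _.
    by rewrite -[LHS]/((a * u k + v k) * b k); ring.
  exact: (cvgD (cvgMl_tmp (phiP u)) (phiP v)).
pose phi' : {linear ell1 R -> R^o} := HB.pack phi (GRing.isLinear.Build _ _ _ _ _ lphi).
by exists phi'.
Qed.

Lemma ell1_basis_pairing (b : nat -> R) k :
  (\sum_(0 <= j < n) ell1_basis k j * b j : R) @[n --> \oo] --> (b k : R).
Proof.
apply: cvg_near_cst; near=> n.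
have kn : (k < n)%N by near: n; exists k.+1.
rewrite big_mkord (bigD1 (Ordinal kn))//= ell1_basisE eqxx mul1r big1 ?addr0// => j.
by rewrite -val_eqE /= ell1_basisE => /negPf ->; rewrite mul0r.
Unshelve. all: by end_near. Qed.

Lemma ell1_shift (u : ell1 R) : exists2 v : ell1 R,
  (forall k, v k = if k is j.+1 then u j else 0) & `|v| <= `|u|.
Proof.
pose f k : R := if k is j.+1 then u j else 0.
have fE n : \sum_(0 <= k < n.+1) `|f k| = psum u n.
  by rewrite big_nat_recl//= normr0 add0r.
have f_le n : \sum_(0 <= k < n) `|f k| <= `|u|.
  case: n => [|n]; first by rewrite big_geq.
  by rewrite fE ell1_psum_le.
have [v vf] := ell1_of f_le; exists v; first by move=> k; rewrite vf.
apply: ell1_norm_le => n; rewrite /psum.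
by rewrite (eq_bigr (fun k => `|f k|)) // => k _; rewrite vf.
Qed.

End ell1_pairing.

(** * A weak-star compact simplex and its shift *)

Section simplex.
Context {R : realType} {Y : completeNormedModType R}.
Variables (y_ : nat -> dual Y) (y0 : dual Y).
Hypotheses (y_1 : forall k, `|y_ k| <= 1) (y01 : `|y0| <= 1)
  (y_y0 : forall x, (y_ k x : R^o) @[k --> \oo] --> (y0 x : R^o))
  (lower : forall K (a : nat -> R),
    \sum_(0 <= k < K) `|a k| + `|\sum_(0 <= k < K) a k| <=
    `|\sum_(0 <= k < K) a k *: (y_ k - y0)|).

(** [Phi u] is the pointwise sum of the [u k *: (y_ k - y0)]. The lower bound extends from finite
    sums by truncation: the tail counts twice through [Phi], once through [sigma] and once through
    the norm of [u], whence the factor 4. *)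
Lemma simplex_map : exists (sigma : {linear ell1 R -> R^o}) (Phi : {linear ell1 R ->
  dual Y}),
  [/\ forall u : ell1 R, (\sum_(0 <= k < n) u k : R) @[n --> \oo] --> (sigma u : R),
      forall (u : ell1 R) x, (\sum_(0 <= k < n) u k * (y_ k x - y0 x) : R) @[n --> \oo]
        --> (Phi u x : R) &
      forall u, `|Phi u| = `|u| + `|sigma u| ].
Proof.
have [|sigma0 sigma0P] := @ell1_pairing R (fun=> 1) 1; first by rewrite normr1.
have sigmaP (u : ell1 R) : (\sum_(0 <= k < n) u k : R) @[n --> \oo] --> (sigma0 u : R).
  rewrite (_ : (fun n => _) = (fun n => \sum_(0 <= k < n) u k * 1)); first exact: sigma0P.
  by apply/funext => n; apply: eq_bigr => k _; rewrite mulr1.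
have sigma_le u : `|sigma0 u| <= `|u|.
  apply: (cvgr_to_le (cvg_norm (sigmaP u))); near=> n.
  by apply: le_trans (ler_norm_sum _ _ _) (ell1_psum_le u n).
have le1 (f : dual Y) x : `|f| <= 1 -> `|f x| <= `|x|.
  by move=> f1; apply: le_trans (dual_le_norm _ _) _; rewrite ler_piMl.
have z2 x k : `|y_ k x - y0 x| <= 2 * `|x|.
  apply: le_trans (ler_normB _ _) _; rewrite mulr_natl mulr2n.
  by apply: lerD; exact: le1.
have /choice[phi phiP] x := @ell1_pairing R (fun k => y_ k x - y0 x) (2 * `|x|) (z2 x).
have phi_le (u : ell1 R) x : `|phi x u| <= (`|u| + `|sigma0 u|) * `|x|.
  have c1 : ((psum u n + `|\sum_(0 <= k < n) u k|) * `|x|) @[n --> \oo] -->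
      ((`|u| + `|sigma0 u|) * `|x|).
    by apply: cvgMr_tmp; exact: cvgD (@ell1_psum_cvg R u) (cvg_norm (sigmaP u)).
  apply: (cvg_ler _ (cvg_norm (phiP x u)) c1); near=> n.
  have -> : \sum_(0 <= k < n) u k * (y_ k x - y0 x) =
      \sum_(0 <= k < n) u k * y_ k x - (\sum_(0 <= k < n) u k) * y0 x.
    by rewrite mulr_suml -sumrB; apply: eq_bigr => k _; rewrite mulrBr.
  apply: le_trans (ler_normB _ _) _; rewrite mulrDl; apply: lerD.
    apply: le_trans (ler_norm_sum _ _ _) _; rewrite mulr_suml; apply: ler_sum => k _.
    by rewrite normrM ler_wpM2l// le1.
  by rewrite normrM ler_wpM2l// le1.
have /choice[Phi PhiE] (u : ell1 R) : exists f : dual Y, forall x, f x = phi x u.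
  apply: (@dual_of R Y (fun x => phi x u) (`|u| + `|sigma0 u|)); last exact: phi_le.
  move=> a x x'; apply: (cvg_unique _ (phiP _ u)) => //.
  rewrite (_ : (fun n => _) = (fun n => a * (\sum_(0 <= k < n) u k * (y_ k x - y0 x)) +
      \sum_(0 <= k < n) u k * (y_ k x' - y0 x'))); last first.
    apply/funext => n; rewrite mulr_sumr -big_split/=; apply: eq_bigr => k _.
    rewrite (linearP (y_ k)) (linearP y0).
    by rewrite -[LHS]/(u k * (a * y_ k x + y_ k x' - (a * y0 x + y0 x'))); ring.
  exact: (cvgD (cvgMl_tmp (phiP x u)) (phiP x' u)).
have lPhi : linear Phi.
  move=> a u v; apply/val_inj/funext => x /=.
  by rewrite -[RHS]/(a *: Phi u x + Phi v x) !PhiE linearP.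
pose Phi' : {linear ell1 R -> dual Y} := HB.pack Phi (GRing.isLinear.Build _ _ _ _ _
  lPhi).
have Phi_le u : `|Phi' u| <= `|u| + `|sigma0 u|.
  apply: dual_norm_le => [|x]; first exact: addr_ge0.
  by rewrite /Phi' /= PhiE; exact: phi_le.
have Phi_basis k : Phi' (ell1_basis k) = y_ k - y0.
  apply/val_inj/funext => x; rewrite /Phi' /= PhiE.
  apply: (cvg_unique _ (phiP x _)) => //.
  exact: (@ell1_basis_pairing R (fun k => y_ k x - y0 x)).
exists sigma0, Phi'; split => // [u x|u].
  by rewrite /Phi' /= PhiE; exact: phiP.
apply/eqP; rewrite eq_le Phi_le/=.
have c4 : (`|Phi' u| + 4 * `|ell1_tail K u|) @[K --> \oo] --> (`|Phi' u| + 4 * 0).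
  by apply: cvgD; [exact: cvg_cst|apply: cvgMl_tmp; exact: ell1_tail_cvg].
rewrite mulr0 addr0 in c4; apply: (cvgr_to_ge c4); near=> K.
pose hd := \sum_(0 <= k < K) u k *: ell1_basis k.
have uE : u = hd + ell1_tail K u by rewrite /ell1_tail addrC subrK.
have h1 : `|\sum_(0 <= k < K) u k *: (y_ k - y0)| <= `|Phi' u| + 2 * `|ell1_tail K u|.
  have -> : \sum_(0 <= k < K) u k *: (y_ k - y0) = Phi' u - Phi' (ell1_tail K u).
    rewrite [in X in _ = X - _]uE linearD addrK linear_sum; apply: eq_bigr => k _.
    by rewrite linearZ Phi_basis.
  apply: le_trans (ler_normB _ _) _; rewrite lerD2l.
  apply: le_trans (Phi_le _) _; rewrite mulr_natl mulr2n lerD2l.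
  exact: sigma_le.
have h2 : `|sigma0 u| <= `|\sum_(0 <= k < K) u k| + `|ell1_tail K u|.
  rewrite [in leLHS]uE linearD; apply: le_trans (ler_normD _ _) _.
  apply: lerD; last exact: sigma_le.
  rewrite linear_sum/= le_eqVlt; apply/orP; left; apply/eqP; congr `|_|.
  apply: eq_bigr => k _; rewrite linearZ/= -[LHS]/(u k * sigma0 (ell1_basis k)).
  rewrite -[RHS]mulr1; congr (_ * _).
  apply: (cvg_unique _ (sigma0P _)) => //.
  exact: (@ell1_basis_pairing R (fun=> 1)).
have h3 := ell1_tail_norm K u; have h4 := lower K u.
rewrite -/(psum u K) in h4.
lra.
Unshelve. all: by end_near. Qed.

End simplex.

Section simplex_fixed_point.
Context {R : realType} {Y : completeNormedModType R}.
Variables (y_ : nat -> dual Y) (y0 : dual Y).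
Hypotheses (y_1 : forall k, `|y_ k| <= 1) (y01 : `|y0| <= 1)
  (y_y0 : forall x, (y_ k x : R^o) @[k --> \oo] --> (y0 x : R^o))
  (lower : forall K (a : nat -> R),
    \sum_(0 <= k < K) `|a k| + `|\sum_(0 <= k < K) a k| <=
    `|\sum_(0 <= k < K) a k *: (y_ k - y0)|).

(* The isometric right shift of the simplex spanned by [y0] and the [y_ k],
   which moves the mass at [y0] to [y_ 0], has no fixed point. *)
Lemma simplex_not_fpp : ~ weak_star_fpp Y.
Proof.
move=> fpp.
have [sigma [Phi [sigmaP PhiP Phin]]] := simplex_map y_1 y01 lower.
pose Delta := [set c : ell1 R | (forall k, 0 <= c k) /\ `|c| <= 1].
(* [y0 + Phi c] has weight [c k] at [y_ k] and the missing mass [1 - sigma c] at [y0]. *)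
pose C : set (dual Y) := [set y0 + Phi c | c in Delta].
have sigma_norm (c : ell1 R) : (forall k, 0 <= c k) -> sigma c = `|c|.
  move=> c0; apply: (cvg_unique _ (sigmaP c)) => //.
  rewrite (_ : (fun n => _) = psum c); first exact: ell1_psum_cvg.
  by apply/funext => n; apply: eq_bigr => k _; rewrite ger0_norm.
have sigma_e0 : sigma (ell1_basis 0) = 1.
  by rewrite sigma_norm ?ell1_basis_norm// => k; rewrite ell1_basisE.
have /choice[sh shP] (u : ell1 R) : exists v : ell1 R,
    (forall k, v k = if k is j.+1 then u j else 0) /\ `|v| <= `|u|.
  by have [v v1 v2] := ell1_shift u; exists v.
have shE u := (shP u).1; have sh_le u := (shP u).2.
have shB u v : sh u - sh v = sh (u - v).
  apply: ell1_ext => k; rewrite -[LHS]/(sh u k - sh v k) !shE.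
  by case: k => [|k]; rewrite ?subrr.
have sigma_sh u : sigma (sh u) = sigma u.
  apply: (cvg_unique _ _ (sigmaP u)) => //.
  have := sigmaP (sh u); rewrite -(cvg_shiftS (fun n => \sum_(0 <= k < n) sh u k)) /=.
  rewrite (_ : (fun n => _) = (fun n => \sum_(0 <= k < n) u k))//.
  apply/funext => n; rewrite big_nat_recl// shE add0r.
  by apply: eq_bigr => k _; rewrite shE.
pose next c := sh c + (1 - sigma c) *: ell1_basis 0.
have next_Delta c : Delta c -> Delta (next c).
  move=> [c0 c1]; have s1 : 0 <= 1 - sigma c by rewrite sigma_norm ?subr_ge0.
  split=> [k|].
    rewrite -[next c k]/(sh c k + (1 - sigma c) * ell1_basis 0 k) shE ell1_basisE.
    by apply: addr_ge0; [case: k|exact: mulr_ge0].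
  apply: le_trans (ler_normD _ _) _.
  rewrite normrZ ell1_basis_norm mulr1 (ger0_norm s1) sigma_norm// addrCA -lerBrDl subrr.
  by rewrite subr_le0 sh_le.
(* Outside [C] the coefficients default to 0, so the bound by 1 holds for all [y] and limits along
   any ultrafilter exist. *)
have /choice[cf cfP] (y : dual Y) : exists c : ell1 R, `|c| <= 1 /\
    (C y -> Delta c /\ y = y0 + Phi c).
  have [[c [c0 c1] <-]|nCy] := pselect (C y); first by exists c.
  by exists 0; rewrite normr0.
pose T y := y0 + Phi (next (cf y)).
have TC y : C y -> C (T y).
  by move=> Cy; exists (next (cf y)) => //; apply: next_Delta; case: ((cfP y).2 Cy).
have [] := fpp C _ _ _ (mkfun_fun TC).
- exists (y0 + Phi 0), 0 => //; split => //=; by rewrite normr0.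
- move=> y w t; rewrite !inE => -[c [c0 c1] <-] [c' [c'0 c'1] <-].
  have t0 : 0 <= t%:num by [].
  have t1 : 0 <= 1 - t%:num by rewrite subr_ge0.
  exists (t%:num *: c + (1 - t%:num) *: c').
    split=> [k|].
      rewrite -[X in 0 <= X]/(t%:num * c k + (1 - t%:num) * c' k).
      by apply: addr_ge0; apply: mulr_ge0.
    apply: le_trans (ler_normD _ _) _; rewrite !normrZ !ger0_norm//.
    apply: le_trans (lerD (ler_wpM2l t0 c1) (ler_wpM2l t1 c'1)) _.
    by rewrite !mulr1 addrC subrK.
  rewrite linearD !linearZ/=.
  rewrite -[RHS]/(t%:num *: (y0 + Phi c) + (1 - t%:num) *: (y0 + Phi c')).
  by rewrite !scalerDr addrACA -scalerDl [_ + (1 - _)]addrC subrK scale1r.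
(* Coordinatewise limits of the coefficients suffice because [y_ k x - y0 x] tends to 0: mass
   escaping to infinity is absorbed by [y0]. *)
- apply: weak_star_compactI => F FU FC.
  have [mu muP] := @ell1_ultra_limit R _ F cf 1 FU (fun y => (cfP y).1).
  have muD : Delta mu.
    split=> [k|].
      apply: (cvgr_to_ge (muP k)); apply: filterS FC => y Cy.
      by case: ((cfP y).2 Cy) => -[].
    apply: ell1_norm_le => n.
    have cn := psum_cvg (N := n) (@ultra_proper _ _ FU) muP; apply: (cvgr_to_le cn);
      near=> y.
    by apply: le_trans (ell1_psum_le _ _) (cfP y).1.
  exists (y0 + Phi mu); first by exists mu.
  move=> x; change ((fun h : dual Y => h x : R^o) @ F --> ((y0 + Phi mu) x : R^o)).
  have d0 k : ((cf y - mu) k : R^o) @[y --> F] --> (0 : R^o).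
    rewrite -[X in _ --> X](subrr (mu k : R^o)).
    exact: (cvgB (muP k) (cvg_cst _)).
  have lx : linear (fun u => Phi u x : R^o) by move=> a u v; rewrite linearP.
  pose phi : {linear ell1 R -> R^o} := HB.pack (fun u => Phi u x : R^o)
    (GRing.isLinear.Build _ _ _ _ _ lx).
  have phi_le u : `|phi u| <= 2 * `|x| * `|u|.
    apply: le_trans (dual_le_norm _ _) _; rewrite mulrAC ler_wpM2r// Phin.
    rewrite mulr_natl mulr2n lerD2l.
    apply: (cvgr_to_le (cvg_norm (sigmaP u))); near=> n.
    by apply: le_trans (ler_norm_sum _ _ _) (ell1_psum_le u n).
  have phi_basis k : phi (ell1_basis k) = y_ k x - y0 x.
    apply: (cvg_unique _ (PhiP _ x)) => //.
    exact: (@ell1_basis_pairing R (fun k => y_ k x - y0 x)).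
  apply/cvgrPdist_le => e e0.
  have e4 : 0 < e / 4 by lra.
  have /cvgrPdistC_le/(_ _ e4)[N _ hN] := @y_y0 x.
  have cN : (2 * `|x| * psum (cf y - mu) N : R) @[y --> F] --> (2 * `|x| * 0 : R).
    by apply: cvgMl_tmp; exact: psum_cvg0.
  rewrite mulr0 in cN.
  have e2 : 0 < e / 2 by lra.
  have cN2 := cvgr_le _ cN _ e2.
  have FC' : \forall y \near F, C y by [].
  near=> y.
  have Cy : C y by near: y; exact: FC'.
  have h1 : 2 * `|x| * psum (cf y - mu) N <= e / 2 by near: y; exact: cN2.
  have [_ yE] := (cfP y).2 Cy.
  rewrite distrC {1}yE.
  have -> : (y0 + Phi (cf y)) x - (y0 + Phi mu) x = phi (cf y - mu).
    by rewrite linearB -[LHS]/(y0 x + Phi (cf y) x - (y0 x + Phi mu x)) /=; ring.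
  have h2 : `|phi (cf y - mu)| <= 2 * `|x| * psum (cf y - mu) N + e / 4 * `|cf y - mu|.
    apply: ell1_functional_le => //; first exact: ltW.
    by move=> k Nk; rewrite phi_basis; exact: hN.
  have h3 : `|cf y - mu| <= 2.
    apply: le_trans (ler_normB _ _) _.
    by have := (cfP y).1; have := muD.2; lra.
  have h4 : e / 4 * `|cf y - mu| <= e / 4 * 2 by rewrite ler_wpM2l// ltW.
  by apply: le_trans h2 _; lra.
- move=> y w; rewrite !inE => Cy Cw.
  rewrite -[mkfun_fun TC y]/(T y) -[mkfun_fun TC w]/(T w).
  have [_ yE] := (cfP y).2 Cy; have [_ wE] := (cfP w).2 Cw.
  rewrite {2}yE {2}wE /T !opprD !addrA.
  rewrite [y0 + _ - y0]addrAC subrr add0r [y0 + _ - y0]addrAC subrr add0r -!linearB.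
  rewrite !Phin; set c := cf y; set c' := cf w.
  (* The mass added at coordinate 0 balances the shifted difference: [sigma] becomes 0, and its
     former modulus reappears in the l1 norm. *)
  have -> : next c - next c' = sh (c - c') - sigma (c - c') *: ell1_basis 0.
    rewrite /next opprD addrACA shB; congr (_ + _).
    by rewrite -scalerBl linearB/= -scaleNr; congr (_ *: _); ring.
  have -> : sigma (sh (c - c') - sigma (c - c') *: ell1_basis 0) = 0.
    by rewrite linearB linearZ sigma_sh /= sigma_e0 [_ *: 1]mulr1 subrr.
  rewrite normr0 addr0; apply: le_trans (ler_normB _ _) _.
  by rewrite normrZ ell1_basis_norm mulr1 lerD2r.
- move=> y Cy; rewrite -[mkfun_fun TC y]/(T y) => Ty.
  have [_ yE] := (cfP y).2 Cy.
  have cE : next (cf y) = cf y.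
    apply/eqP; rewrite -subr_eq0 -normr_le0;
      apply: le_trans (_ : `|Phi (next (cf y) - cf y)| <= 0).
      by rewrite Phin lerDl.
    have : y0 + Phi (next (cf y)) = y0 + Phi (cf y) by rewrite -yE -[RHS]Ty.
    by move=> /addrI E; rewrite linearB E subrr normr0.
  set c := cf y in cE.
  (* A fixed point has constant coordinates, so it is 0 in l1, whereas coordinate 0 receives the
     missing mass, which is then 1. *)
  have cS k : c k.+1 = c k.
    rewrite -[in LHS]cE -[LHS]/(sh c k.+1 + (1 - sigma c) * ell1_basis 0 k.+1).
    by rewrite shE ell1_basisE mulr0 addr0.
  have ck k : c k = c 0%N by elim: k => // k <-; exact: cS.
  have c00 : c 0%N = 0.
    apply/eqP; rewrite -normr_le0; apply: (cvgr_to_ge (ell1_tail_cvg c)); near=> k.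
    have := ell1_coord_le (ell1_tail k c) k.
    by rewrite ell1_tailE ltnn ck.
  have c0 : c = 0 by apply: ell1_ext => k; rewrite ck c00.
  have : c 0%N = 1.
    rewrite -[in LHS]cE -[LHS]/(sh c 0%N + (1 - sigma c) * ell1_basis 0 0%N).
    by rewrite shE ell1_basisE eqxx c0 linear0 subr0 mulr1 add0r.
  by rewrite c00 => /esym/eqP; rewrite oner_eq0.
Unshelve. all: by end_near. Qed.

End simplex_fixed_point.

(** * Equivalent norms and the Banach-Mazur distance *)

Section renorming.
Context {R : realType} (X : completeNormedModType R).

Record equivalent_norm := EquivalentNorm {
  enorm :> X -> R;
  enorm_lo : R;
  enorm_hi : R;
  enormD : forall x y, enorm (x + y) <= enorm x + enorm y;
  enormZ : forall a x, enorm (a *: x) = `|a| * enorm x;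
  enorm_lo_gt0 : 0 < enorm_lo;
  enorm_hi_ge0 : 0 <= enorm_hi;
  enorm_lo_le : forall x, enorm_lo * `|x| <= enorm x;
  enorm_le_hi : forall x, enorm x <= enorm_hi * `|x| }.

(** An alias indexed by the norm, to which a second normed structure can be attached without
    clashing with that of [X]. *)
Definition renormed (N : equivalent_norm) : Type := X.

Section renormed.
Variable N : equivalent_norm.

HB.instance Definition _ := GRing.Lmodule.copy (renormed N) X.

Let norm0 (x : renormed N) : N x = 0 -> x = 0.
Proof.
move=> x0; apply/eqP; rewrite -(@normr_le0 _ X) -(pmulr_rle0 _ (enorm_lo_gt0 N)).
by rewrite -x0; exact: enorm_lo_le.
Qed.

HB.instance Definition _ :=
  Lmodule_isNormed.Build R (renormed N) (enormD N) (enormZ N) norm0.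

Lemma renormedE (x : renormed N) : `|x| = N x. Proof. by []. Qed.

Let complete (F : set_system (renormed N)) : ProperFilter F -> cauchy F -> cvg F.
Proof.
move=> FF /cauchy_ballP cF.
have : cauchy (F : set_system X).
  apply/cauchy_ballP => e e0.
  have := cF (enorm_lo N * e) (mulr_gt0 (enorm_lo_gt0 N) e0).
  apply: filterS => -[x y] /=; rewrite -!ball_normE /= renormedE.
  by move=> h; rewrite -(ltr_pM2l (enorm_lo_gt0 N)); apply: le_lt_trans h;
    exact: enorm_lo_le.
move=> /cauchy_cvg/cvg_ex[l Fl]; apply/cvg_ex; exists (l : renormed N).
apply/cvgrPdist_lt => e e0.
have h0 : 0 < `|enorm_hi N| + 1 by rewrite ltr_wpDl.
have e1 : 0 < e / (`|enorm_hi N| + 1) by rewrite divr_gt0.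
have /cvgrPdist_lt/(_ _ e1) := Fl.
apply: filterS => x; rewrite ltr_pdivlMr// renormedE; apply: le_lt_trans.
apply: le_trans (enorm_le_hi _ _) _; rewrite mulrC ler_wpM2l//.
by apply: le_trans (ler_norm _) _; rewrite lerDl.
Qed.

HB.instance Definition _ := Uniform_isComplete.Build (renormed N) complete.

End renormed.
End renorming.

Lemma bm_distance_renormed {R : realType} (X : completeNormedModType R)
    (N : equivalent_norm X) :
  (bm_distance X (renormed N : completeNormedModType R) <= (enorm_hi N / enorm_lo
    N)%:E)%E.
Proof.
have lid : linear (fun x : X => x : renormed N) by [].
have lid' : linear (fun x : renormed N => x : X) by [].
pose T : {linear X -> renormed N} := HB.pack (fun x : X => x : renormed N)
  (GRing.isLinear.Build _ _ _ _ _ lid).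
pose S : {linear renormed N -> X} := HB.pack (fun x : renormed N => x : X)
  (GRing.isLinear.Build _ _ _ _ _ lid').
have Tle x : `|T x| <= enorm_hi N * `|x| by exact: enorm_le_hi.
have Sle x : `|S x| <= (enorm_lo N)^-1 * `|x|.
  by rewrite ler_pdivlMl ?enorm_lo_gt0//; exact: enorm_lo_le.
have cT := bounded_linear_continuous Tle; have cS := bounded_linear_continuous Sle.
apply: (@le_trans _ _ (opnorm T * opnorm S)%:E).
  by apply: ereal_inf_lbound; exists T, S; split.
rewrite lee_fin.
have hS : opnorm S <= (enorm_lo N)^-1.
  apply: opnorm_le => x x1; apply: le_trans (Sle x) _.
  by rewrite ler_piMr// invr_ge0 ltW// enorm_lo_gt0.
apply: ler_pM => //; [exact: opnorm_ge0|exact: opnorm_ge0|].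
apply: opnorm_le => x x1; apply: le_trans (Tle x) _.
by rewrite ler_piMr// enorm_hi_ge0.
Qed.

(** * Weak-star convergent subsequences *)

Lemma rat_approx {R : realType} (x e : R) : 0 < e -> exists q : rat, `|x - ratr q| <= e.
Proof.
move=> e0; have [|q] := @rat_in_itvoo R (x - e) (x + e); first by lra.
rewrite in_itv /= => /andP[h1 h2]; exists q.
by rewrite ler_norml; apply/andP; split; lra.
Qed.

(** Finitely supported rational vectors are dense in l1; choosing for each a vector of the unit ball
    where it reaches half its norm gives a countable set on which no nonzero functional vanishes. *)
Lemma total_sequence {R : realType} (X : completeNormedModType R) :
  isometrically_isomorphic (dual X) (ell1 R) ->
  exists d : nat -> X, forall f : dual X, (forall j, f (d j) = 0) -> f = 0.
Proof.
move=> hX; have [J [P [JK PK Jn]]] := isometry_inverse hX.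
have Pn u : `|P u| = `|u| by rewrite -Jn PK.
pose w (q : seq rat) : ell1 R := \sum_(0 <= k < size q) ratr (nth 0 q k) *: ell1_basis k.
have /choice[x xP] (q : seq rat) : exists x, `|x| <= 1 /\ `|P (w q)| / 2 <= P (w q) x.
  have [->|n0] := eqVneq (P (w q)) 0; first by exists 0; rewrite !normr0 mul0r linear0.
  have n1 : 0 < `|P (w q)| by rewrite normr_gt0.
  have [|x x1 hx] := @dual_norm_gt _ _ (P (w q)) (`|P (w q)| / 2); first by lra.
  by exists x; rewrite x1 ltW.
exists (fun n => if unpickle n is Some q then x q else 0) => f fd.
apply/eqP; apply: contrapT => /negP f0.
set a := `|f|; have a0 : 0 < a by rewrite normr_gt0.
have a8 : 0 < a / 8 by lra.
have [N _ hN] := cvgr_lt _ (ell1_tail_cvg (J f)) _ a8.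
have tN := hN N (leqnn N).
have del0 : 0 < a / 8 / N.+1%:R by rewrite divr_gt0.
have /choice[r rP] k := rat_approx (J f k) del0.
pose q := mkseq r N.
have sq : size q = N by rewrite size_mkseq.
have uw : `|J f - w q| <= a / 4.
  have -> : J f - w q = ell1_tail N (J f) +
      \sum_(0 <= k < N) (J f k - ratr (nth 0 q k)) *: ell1_basis k.
    rewrite /ell1_tail /w sq -addrA; congr (_ + _).
    rewrite -!sumrN -big_split; apply: eq_bigr => k _ /=.
    by rewrite scalerBl addrA addNr sub0r.
  apply: le_trans (ler_normD _ _) _.
  have : `|\sum_(0 <= k < N) (J f k - ratr (nth 0 q k)) *: ell1_basis k| <= a / 8.
    apply: le_trans (ler_norm_sum _ _ _) _.
    apply: le_trans (_ : \sum_(0 <= k < N) a / 8 / N.+1%:R <= _).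
      rewrite big_nat_cond [leRHS]big_nat_cond; apply: ler_sum => k /andP[/andP[_ kN] _].
      by rewrite normrZ ell1_basis_norm mulr1 nth_mkseq.
    rewrite sumr_const_nat subn0 -[_ *+ N]mulr_natr mulrAC ler_pdivrMr//.
    by rewrite ler_wpM2l ?(ltW a8)// ler_nat.
  lra.
have [x1 hx] := xP q.
have fx : f (x q) = 0 by have := fd (pickle q); rewrite pickleK.
have h1 : P (w q) (x q) <= `|P (w q) - f|.
  have -> : P (w q) (x q) = (P (w q) - f) (x q).
    by rewrite -[RHS]/(P (w q) (x q) - f (x q)) fx subr0.
  apply: le_trans (ler_norm _) _; apply: le_trans (dual_le_norm _ _) _.
  by rewrite ler_piMr.
have h2 : `|P (w q) - f| <= a / 4 by rewrite -{1}[f]JK -linearB Pn distrC.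
have h3 : a <= `|P (w q)| + `|P (w q) - f|.
  rewrite /a -[X in `|X| <= _](subKr (P (w q))); exact: ler_normB.
(* [P (w q)] has norm at most [a / 2] and lies within [a / 4] of [f], whose norm is [a]. *)
have : a <= 0 by lra.
by rewrite leNgt a0.
Qed.

(** The ultrafilter limit supplies [g] before any subsequence is chosen. The subsequence is made to
    converge on the total sequence; every ultrafilter limit of the differences then vanishes there,
    hence everywhere. *)
Lemma weak_star_subsequence {R : realType} (X : completeNormedModType R)
    (y : nat -> dual X) (M : R) :
  isometrically_isomorphic (dual X) (ell1 R) -> (forall n, `|y n| <= M) ->
  exists (s : nat -> nat) (g : dual X), (forall k, (s k < s k.+1)%N) /\
    forall x, (y (s k) x : R^o) @[k --> \oo] --> (g x : R^o).
Proof.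
move=> hX yM; have [d dT] := total_sequence hX.
have [|U [UU _ Uoo]] := @free_ultrafilter setT; first by move=> N; exists N.
have [g gM gU] := dual_ultra_limit UU yM.
have /choice[nxt nxtP] (km : nat * nat) : exists n, (km.2 < n)%N /\
    forall j, (j <= km.1)%N -> `|y n (d j) - g (d j)| < km.1.+1%:R^-1.
  case: km => k m /=.
  have Um : \forall n \near U, (m < n)%N by apply: Uoo; exists m.+1.
  have Uj i : \forall n \near U, forall j, (j < i)%N -> `|y n (d j) - g (d j)| <
    k.+1%:R^-1.
    elim: i => [|i IH]; first by near=> n.
    have /cvgrPdistC_lt/(_ k.+1%:R^-1) := gU (d i).
    rewrite invr_gt0 ltr0n => /(_ isT) Ui; apply: filterS2 IH Ui => n h1 h2 j.
    by rewrite ltnS leq_eqVlt => /predU1P[->|]; [exact: h2|exact: h1].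
  have [n [h1 h2]] := filter_ex (filterI Um (Uj k.+1)).
  by exists n.
pose s := fix s k := if k is i.+1 then nxt (k, s i) else nxt (0%N, 0%N).
have sS k : (s k < s k.+1)%N by have [] := nxtP (k.+1, s k).
have sd k j : (j <= k)%N -> `|y (s k) (d j) - g (d j)| < k.+1%:R^-1.
  by case: k => [|k]; [apply: (nxtP (0%N, 0%N)).2|apply: (nxtP (k.+1, s k)).2].
exists s, g; split => // x; apply/cvgrPdist_le => e e0; apply: contrapT => H.
have [|F [FU FA Foo]] := @free_ultrafilter [set k | e < `|g x - y (s k) x|].
  move=> N; apply: contrapT => hN; apply: H; exists N => // k /= Nk.
  by rewrite leNgt; apply/negP => ?; apply: hN; exists k.
have zM k : `|y (s k) - g| <= M + M.
  by apply: le_trans (ler_normB _ _) _; apply: lerD.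
have [z _ zF] := dual_ultra_limit FU zM.
have z0 : z = 0.
  apply: dT => j; apply: (cvg_unique _ (zF (d j))) => //.
  apply/cvgrPdist_le => c c0; apply: Foo; near=> k.
  rewrite sub0r normrN; apply: le_trans (ltW (sd k j _)) _.
    by near: k; exists j.
  by apply/ltW; near: k; exact: (near_infty_natSinv_lt (PosNum c0)).
have : e <= `|z x|.
  apply: (cvgr_to_ge (cvg_norm (zF x))).
  by apply: filterS FA => k /ltW; rewrite distrC.
by rewrite z0 -[(0 : dual X) x]/(0 : R) normr0 leNgt e0.
Unshelve. all: by end_near. Qed.

(** Hahn-Banach extension from the range of [U]: the cone is the graph of [U u |-> u n], a subspace,
    so its inequality at [u] and at [- u] is an equality. *)
Lemma coordinate_extension {R : realType} (X : completeNormedModType R)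
    (U : {linear c_space R -> X}) (c : R) n : 0 < c ->
  (forall u, c * `|u| <= `|U u|) ->
  exists2 f : dual X, `|f| <= c^-1 & forall u, f (U u) = u n.
Proof.
move=> c0 cU; pose p (x : X) := c^-1 * `|x|.
have ci : 0 <= c^-1 by rewrite invr_ge0 ltW.
have sp : sublinear p.
  split=> [x y|t x t0]; first by rewrite /p -mulrDr ler_wpM2l// ler_normD.
  by rewrite /p normrZ gtr0_norm// mulrCA.
pose S := [set ((U u, u n) : X * R) | u in setT].
have [||phi [phip Sphi]] := @mazur_orlicz R X p S sp.
- split.
  + by exists 0 => //; rewrite linear0.
  + by move=> _ _ [u _ <-] [v _ <-]; exists (u + v) => //; rewrite linearD.
  + by move=> t _ t0 [u _ <-]; exists (t *: u) => //; rewrite linearZ.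
- move=> _ [u _ <-] /=; rewrite /p ler_pdivlMl//; apply: le_trans (cU u).
  by rewrite ler_pM2l//; apply: le_trans (ler_norm _) (c_coord_le u n).
have phi1 z : `|phi z| <= c^-1 * `|z|.
  by rewrite ler_norml phip andbT lerNl -linearN -[`|z|]normrN; exact: phip.
have [f fE] := dual_of (linearP phi) phi1; exists f.
  by apply: dual_norm_le => // z; rewrite fE.
move=> u; apply/eqP; rewrite eq_le fE; apply/andP; split.
  rewrite -lerN2 -linearN -[U u]opprK -!linearN/= opprK.
  by have := Sphi (U (- u), (- u) n); rewrite /= linearN; apply; exists (- u);
    rewrite ?linearN.
by have := Sphi (U u, u n); apply; exists u.
Qed.

(** * The renorming attached to a copy of c *)

Section sup_norm.
Context {R : realType} (X : completeNormedModType R) (y : nat -> dual X) (a b : R).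
Hypotheses (a0 : 0 < a) (b0 : 0 <= b) (ab : a <= b) (yb : forall k, `|y k| <= b).

(** The [y k] alone need not separate points; the term [a * |x|] keeps the norm equivalent to the
    original one. *)
Definition sup_norm (x : X) : R := Num.max (a * `|x|) (sup (range (fun k => `|y k x|))).

Let yxb k x : `|y k x| <= b * `|x|.
Proof. by apply: le_trans (dual_le_norm _ _) _; rewrite ler_wpM2r. Qed.

Lemma sup_norm_le x M : a * `|x| <= M -> (forall k, `|y k x| <= M) -> sup_norm x <= M.
Proof.
move=> xM yM; rewrite ge_max xM/=; apply: ge_sup; first by exists `|y 0%N x|; exists 0%N.
by move=> _ [k _ <-].
Qed.

Lemma le_sup_norm x k : `|y k x| <= sup_norm x.
Proof.
rewrite le_max; apply/orP; right; apply: ub_le_sup; last by exists k.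
by exists (b * `|x|) => _ [j _ <-].
Qed.

Lemma sup_norm_lower x : a * `|x| <= sup_norm x.
Proof. by rewrite le_max lexx. Qed.

Lemma sup_norm_upper x : sup_norm x <= b * `|x|.
Proof. by apply: sup_norm_le => //; rewrite ler_wpM2r. Qed.

Lemma sup_normD x z : sup_norm (x + z) <= sup_norm x + sup_norm z.
Proof.
apply: sup_norm_le => [|k].
  apply: le_trans (lerD (sup_norm_lower x) (sup_norm_lower z)).
  by rewrite -mulrDr ler_wpM2l ?(ltW a0)// ler_normD.
rewrite linearD; apply: le_trans (ler_normD _ _) _.
by apply: lerD; exact: le_sup_norm.
Qed.

Lemma sup_normZ t x : sup_norm (t *: x) = `|t| * sup_norm x.
Proof.
have le s z : sup_norm (s *: z) <= `|s| * sup_norm z.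
  apply: sup_norm_le => [|k].
    by rewrite normrZ mulrCA ler_wpM2l// sup_norm_lower.
  by rewrite linearZ/= [leLHS]normrM ler_wpM2l// le_sup_norm.
apply/eqP; rewrite eq_le le/=; have [->|t0] := eqVneq t 0.
  by rewrite normr0 mul0r scale0r; apply: le_trans (sup_norm_lower 0);
    rewrite normr0 mulr0.
have := le t^-1 (t *: x).
by rewrite scalerA mulVf// scale1r normfV ler_pdivlMl ?normr_gt0.
Qed.

Definition sup_equivalent_norm : equivalent_norm X :=
  EquivalentNorm sup_normD sup_normZ a0 b0 sup_norm_lower sup_norm_upper.

End sup_norm.

Theorem almost_isometric_copies_not_stable {R : realType} (X : completeNormedModType R) :
  isometrically_isomorphic (dual X) (ell1 R) -> almost_isometric_copies_c X ->
  ~ stable_weak_star_fpp X.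
Proof.
move=> hX copies [gam gam1 st].
(* Chosen so that [(1 + eps) / (1 - eps) < gam], the left side being the bound on the distance to
   the renormed space. *)
pose eps : R := (gam - 1) / (2 * (gam + 1)).
have g2 : 0 < 2 * (gam + 1) by lra.
have eps0 : 0 < eps by rewrite divr_gt0// subr_gt0.
have epsE : eps * (2 * (gam + 1)) = gam - 1 by rewrite divfK// gt_eqF.
have eps1 : 0 < 1 - eps by nra.
have e1 : 0 < 1 + eps by lra.
have epsg : (1 - eps)^-1 / (1 + eps)^-1 < gam.
  by rewrite invrK mulrC ltr_pdivrMr//; nra.
have [U [_ Ub]] := copies eps eps0.
have U_ge u : (1 - eps) * `|u| <= `|U u| by case/andP: (Ub u).
have U_le u : `|U u| <= (1 + eps) * `|u| by case/andP: (Ub u).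
have /choice[y0 y0P] n : exists f : dual X, `|f| <= (1 - eps)^-1 /\ forall u, f (U u) =
  u n.
  by have [f f1 fU] := coordinate_extension n eps1 U_ge; exists f.
(* On the range of [U] the extensions converge already, being the coordinates of convergent
   sequences; on all of [X] a subsequence is extracted. *)
have [s [g [sS yg]]] := weak_star_subsequence hX (fun n => (y0P n).1).
pose y k := y0 (s k).
have yU k u : y k (U u) = u (s k) := (y0P (s k)).2 u.
have a0 : 0 < (1 + eps)^-1 by rewrite invr_gt0.
have b0 : 0 <= (1 - eps)^-1 by rewrite invr_ge0 ltW.
have ab : (1 + eps)^-1 <= (1 - eps)^-1 by rewrite lef_pV2 ?posrE//; lra.
have yb k : `|y k| <= (1 - eps)^-1 := (y0P (s k)).1.
pose N := sup_equivalent_norm a0 b0 ab yb.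
pose Y : completeNormedModType R := renormed N.
have /choice[Y_ Y_E] k : exists f : dual Y, `|f| <= 1 /\ forall x, f x = y k x.
  have le (x : Y) : `|y k x| <= 1 * `|x| by rewrite mul1r; exact: (le_sup_norm _ yb).
  have [f fE] := @dual_of R Y (fun x => y k x) 1 (dual_linear (y k)) le.
  by exists f; split => //; apply: dual_norm_le => // x; rewrite fE.
have [Y0 [Y01 Y0E]] : exists f : dual Y, `|f| <= 1 /\ forall x, f x = g x.
  have le (x : Y) : `|g x| <= 1 * `|x|.
    rewrite mul1r; apply: (cvgr_to_le (cvg_norm (yg x))); near=> k.
    exact: (le_sup_norm _ yb).
  have [f fE] := @dual_of R Y (fun x => g x) 1 (dual_linear g) le.
  by exists f; split => //; apply: dual_norm_le => // x; rewrite fE.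
have mono : {homo s : i j / (i < j)%N} by apply: homo_ltn; [exact: ltn_trans|exact: sS].
have s_inj i j : (s i == s j) = (i == j).
  by case: (ltngtP i j) => [/mono/ltn_eqF|/mono/gtn_eqF|->] //; rewrite eqxx.
have s_ge k : (k <= s k)%N by elim: k => // k /leq_ltn_trans; apply.
apply: (@simplex_not_fpp R Y Y_ Y0 (fun k => (Y_E k).1) Y01).
- move=> x; rewrite Y0E (_ : (fun k => _) = (fun k => y k x)); first exact: yg.
  by apply/funext => k; case: (Y_E k).
(* The lower bound is reached at [U u], where [u] takes the sign of [a k] at [s k] and is elsewhere
   [t], opposite in sign to [A]; [g] sees only the limit [t]. *)
- move=> K a; set A := \sum_(0 <= k < K) a k; pose t : R := - Num.sg A.
  have sg1 (r : R) : `|Num.sg r| <= 1 by rewrite normr_sg; case: (_ != _).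
  pose f n : R := t + \sum_(0 <= k < K) (Num.sg (a k) - t) * (n == s k)%:R.
  have fs j : (j < K)%N -> f (s j) = Num.sg (a j).
    move=> jK; rewrite /f big_mkord (bigD1 (Ordinal jK))//= eqxx mulr1 big1 ?addr0.
      by rewrite addrC subrK.
    by move=> i; rewrite -val_eqE /= s_inj eq_sym => /negPf ->; rewrite mulr0.
  have ft n : (forall j, (j < K)%N -> n != s j) -> f n = t.
    move=> nK; rewrite /f big_mkord big1 ?addr0// => i _.
    by rewrite (negPf (nK _ (ltn_ord i))) mulr0.
  have f1 n : `|f n| <= 1.
    have [[j [jK ->]]|h] := pselect (exists j, (j < K)%N /\ n = s j); first by rewrite fs.
    rewrite ft ?normrN// => j jK; apply/eqP => nj; apply: h.
    by exists j.
  have f_far n : (s K <= n)%N -> f n = t.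
    move=> Kn; apply: ft => j jK; rewrite gtn_eqF//; apply: leq_trans Kn.
    exact: mono.
  have fl : f @ \oo --> (t : R^o).
    by apply: cvg_near_cst; exists (s K) => // n /= Kn; rewrite f_far.
  have [u uf] := c_of fl.
  have u1 : `|u| <= 1 by apply: c_norm_le => n; rewrite uf.
  have gU : g (U u) = t.
    apply: (cvg_unique _ (yg (U u))) => //; apply: cvg_near_cst.
    exists (s K) => // k /= Kk; rewrite -/(y k) yU uf f_far//.
    exact: leq_trans (s_ge k).
  (* The factor [(1 + eps)^-1] in the new norm compensates the bound [1 + eps] on [U]. *)
  have UN : `|U u : Y| <= 1.
    apply: sup_norm_le => [|k].
      by rewrite ler_pdivrMl// mulr1; apply: le_trans (U_le u) _; rewrite ler_piMr// ltW.
    by rewrite yU uf.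
  set F := \sum_(0 <= k < K) _ *: _.
  have FU : F (U u) = \sum_(0 <= k < K) `|a k| + `|A|.
    have -> : F (U u) = \sum_(0 <= k < K) a k * (Y_ k (U u) - Y0 (U u)).
      by rewrite /F; elim/big_rec2 : _ => // k v w _ <-.
    rewrite (eq_big_nat _ _ (F2 := fun k => `|a k| - t * a k)).
      rewrite sumrB -mulr_sumr -/A mulNr opprK; congr (_ + _).
      by rewrite [RHS]normrEsg.
    move=> k /andP[_ kK]; rewrite (Y_E k).2 Y0E gU yU uf fs//.
    by rewrite mulrBr [`|a k|]normrEsg [t * _]mulrC [Num.sg _ * _]mulrC.
  rewrite -FU; apply: le_trans (ler_norm _) _; apply: le_trans (dual_le_norm _ _) _.
  by rewrite ler_piMr.
- apply: st; apply: le_lt_trans (bm_distance_renormed N) _.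
  by rewrite lte_fin.
Unshelve. all: by end_near. Qed.

Theorem theorem8p5 (R : realType) (X : completeNormedModType R)
    (hX : isometrically_isomorphic (dual X) (ell1 R)) :
  [<-> almost_isometric_copies_c X;
       ~ stable_weak_star_fpp X;
       rstar X = 1%R].
Proof.
tfae.
- exact: almost_isometric_copies_not_stable.
- move=> ns; apply/eqP; rewrite eq_le rstar_le1 leNgt.
  by apply/negP => /(rstar_lt1_stable hX).
- exact: rstar1_almost_isometric_copies.
Qed.
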